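(* For every $1<p<2$ there exist an $\ell_p$-strictly singular operator $T$ on $L_p$ and a subspace $X$ of $L_p$ such that the restriction $T_{|X}$ is an isomorphism and $X$ is not isomorphic to a Hilbert space.
   Context: $L_p$ denotes $L_p(0,1)$ (equivalently, $L_p(\mu)$ for any purely non-atomic separable probability measure $\mu$). Operators are bounded and linear; subspaces are closed. An operator $T:X\to Y$ between Banach spaces is $\ell_p$-strictly singular if there is no subspace $Z_0$ of $X$ isomorphic to $\ell_p$ such that $T_{|Z_0}$ is an isomorphism. ''Isomorphism'' for a restriction $T_{|X}$ means linear homeomorphism onto its image; ''isomorphic'' means linearly homeomorphic. *)

(* Defs.v *)
From HB Require Import structures.
From mathcomp Require Import all_boot all_order all_algebra.
From mathcomp Require Import all_classical all_reals all_analysis.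
From mathcomp Require Import measurable_realfun ess_sup_inf.

Set Implicit Arguments.
Unset Strict Implicit.
Unset Printing Implicit Defensive.

Import Order.TTheory GRing.Theory Num.Theory.
Import numFieldNormedType.Exports.

Local Open Scope classical_set_scope.
Local Open Scope ring_scope.

(* The library's [LspaceType mu p1] (almost everywhere classes of measurable
   real functions with finite p-norm) has no algebraic or metric structure; we
   equip it with pointwise operations on representatives and the p-norm. *)

Section Lnorm_ae.
Context d (T : measurableType d) (R : realType).
Variable mu : {measure set T -> \bar R}.

Lemma Lnorm_ae_eq (p : \bar R) (f g : T -> R) :
  measurable_fun setT f -> measurable_fun setT g -> f = g %[ae mu] ->
  'N[mu]_p[EFin \o f]%E = 'N[mu]_p[EFin \o g]%E.
Proof.
move=> mf mg fg; rewrite unlock; case: p => [r||].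
- have mp (h : T -> \bar R) : measurable_fun setT h ->
      measurable_fun setT (fun x => `|h x| `^ r : \bar R)%E.
    move=> mh; apply: (@measurableT_comp _ _ _ _ _ _ (poweR ^~ r)) => //=.
      exact: measurable_poweR.
    exact: measurableT_comp.
  congr (_ `^ _)%E; apply: ge0_ae_eq_integral => //;
    [exact/mp/measurable_EFinP|exact/mp/measurable_EFinP
    |by move=> *; exact: poweR_ge0|by move=> *; exact: poweR_ge0|].
  by apply: filterS fg => x /= + _ => ->.
- case: ifP => // _; apply: eq_ess_sup.
  by apply: filterS fg => x /= ->.
- case: ifP => // _; apply: eq_ess_inf.
  by apply: filterS fg => x /= ->.
Qed.

End Lnorm_ae.

Section Lspace_normed.
Context d (T : measurableType d) (R : realType).
Variables (mu : {measure set T -> \bar R}) (p : \bar R) (p1 : (1 <= p)%E).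
Local Open Scope quotient_scope.
Local Notation L := (LspaceType mu p1).
Local Notation F := (LfunType mu p1).
Local Notation Q := {mfun_ mu, T >-> measurableTypeR R}.

(* [LfunType] and [LspaceType] use two displays for the same Borel structure
   on the reals, hence the explicit repackaging of measurability. *)
Lemma Lfun_measurable (f : F) :
  measurable_fun [set: T] (f : T -> measurableTypeR R).
Proof. exact: (@measurable_funPT _ _ _ _ f). Qed.

Definition Lmfun (f : F) : {mfun T >-> measurableTypeR R} :=
  HB.pack (f : T -> measurableTypeR R)
    (isMeasurableFun.Build _ _ _ _ _ (Lfun_measurable f)).

Definition Lpi (f : F) : Q := \pi_Q (Lmfun f).

Lemma Lpi_ae (f : F) : (Lpi f : T -> R) = f %[ae mu].
Proof.
have /eqmodP : repr (\pi_Q (Lmfun f)) = Lmfun f %[mod Q] by rewrite reprK.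
by move=> /asboolP.
Qed.

Lemma Lpi_finite (f : F) : finite_norm mu p (Lpi f : T -> R).
Proof.
rewrite /finite_norm (@Lnorm_ae_eq _ _ _ _ _ _ f).
- exact: Lfunction_finite.
- exact: (@measurable_funPT _ _ _ _ (repr (Lpi f))).
- exact: (@measurable_funPT _ _ _ _ f).
- exact: Lpi_ae.
Qed.

Definition Lclass (f : F) : L :=
  HB.pack (Lpi f) (@isFinLebesgue.Build d T R mu p p1 _ (Lpi_finite f)).

Lemma Lspace_measurable (x : L) : measurable_fun [set: T] (x : T -> R).
Proof. exact: (@measurable_funPT _ _ _ _ (repr (x : Q))). Qed.

Definition Lrepr_mfun (x : L) : {mfun T >-> R} :=
  HB.pack (x : T -> R) (isMeasurableFun.Build _ _ _ _ _ (Lspace_measurable x)).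

Lemma Lrepr_finite (x : L) : finite_norm mu p (Lrepr_mfun x).
Proof. exact: (@Lebesgue_finite _ _ _ _ _ _ x). Qed.

Definition Lrepr (x : L) : F :=
  HB.pack (x : T -> R) (Lrepr_mfun x)
    (@isLfunction.Build d T R mu p p1 _ (Lrepr_finite x)).

Lemma Lrepr_class (f : F) : (Lrepr (Lclass f) : T -> R) = f %[ae mu].
Proof. exact: Lpi_ae. Qed.

Lemma Lspace_eq (x y : L) : (x : Q) = y -> x = y.
Proof.
case: x y => [x [[cx]]] [y [[cy]]] /= xy.
by rewrite xy in cx *; rewrite (Prop_irrelevance cx cy).
Qed.

Lemma Lclass_eq (f g : F) : (f : T -> R) = g %[ae mu] -> Lclass f = Lclass g.
Proof. by move=> fg; apply/Lspace_eq/eqmodP/asboolP. Qed.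

Lemma LreprK : cancel Lrepr Lclass.
Proof.
move=> x; apply: Lspace_eq; rewrite -[RHS]reprK.
by apply/eqmodP/asboolP; exact: ae_eq_refl.
Qed.

HB.instance Definition _ := gen_eqMixin L.
HB.instance Definition _ := gen_choiceMixin L.

Definition Lspace_add (x y : L) : L := Lclass (Lrepr x + Lrepr y).
Definition Lspace_opp (x : L) : L := Lclass (- Lrepr x).
Definition Lspace_scale (a : R) (x : L) : L := Lclass (a *: Lrepr x).
Definition Lspace_norm (x : L) : R := fine 'N[mu]_p[EFin \o Lrepr x].

Lemma Lclass_add f g : Lspace_add (Lclass f) (Lclass g) = Lclass (f + g).
Proof.
apply: Lclass_eq; have := Lrepr_class g; have := Lrepr_class f.
apply: filterS2 => t ft gt tT.
exact: (congr2 +%R (ft tT) (gt tT)).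
Qed.

Lemma Lclass_opp f : Lspace_opp (Lclass f) = Lclass (- f).
Proof.
apply: Lclass_eq; have := Lrepr_class f.
by apply: filterS => t ft /ft; exact: (congr1 -%R).
Qed.

Lemma Lclass_scale a f : Lspace_scale a (Lclass f) = Lclass (a *: f).
Proof.
apply: Lclass_eq; have := Lrepr_class f.
by apply: filterS => t ft /ft; exact: (congr1 ( *%R a)).
Qed.

Lemma Lclass_norm f : Lspace_norm (Lclass f) = fine 'N[mu]_p[EFin \o f].
Proof.
congr fine; apply: Lnorm_ae_eq; last exact: Lrepr_class.
- exact: (@measurable_funPT _ _ _ _ (Lrepr (Lclass f))).
- exact: (@measurable_funPT _ _ _ _ f).
Qed.

Fact Lspace_addA : associative Lspace_add.
Proof.
move=> x y z; rewrite -[x]LreprK -[y]LreprK -[z]LreprK.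
by rewrite !Lclass_add addrA.
Qed.

Fact Lspace_addC : commutative Lspace_add.
Proof. by move=> x y; rewrite /Lspace_add addrC. Qed.

Fact Lspace_add0 : left_id (Lclass 0) Lspace_add.
Proof. by move=> x; rewrite -[x]LreprK Lclass_add add0r. Qed.

Fact Lspace_addN : left_inverse (Lclass 0) Lspace_opp Lspace_add.
Proof. by move=> x; rewrite -[x]LreprK Lclass_opp Lclass_add addNr. Qed.

HB.instance Definition _ := GRing.isZmodule.Build L
  Lspace_addA Lspace_addC Lspace_add0 Lspace_addN.

Lemma Lclass_is_additive f g : Lclass (f + g) = Lclass f + Lclass g.
Proof. by rewrite -Lclass_add. Qed.

Fact Lspace_scaleA a b x :
  Lspace_scale a (Lspace_scale b x) = Lspace_scale (a * b) x.
Proof. by rewrite -[x]LreprK !Lclass_scale scalerA. Qed.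

Fact Lspace_scale1 : left_id 1 Lspace_scale.
Proof. by move=> x; rewrite -[x]LreprK Lclass_scale scale1r. Qed.

Fact Lspace_scaleDr : right_distributive Lspace_scale +%R.
Proof.
move=> a x y; rewrite -[x]LreprK -[y]LreprK.
by rewrite -Lclass_is_additive !Lclass_scale -Lclass_is_additive scalerDr.
Qed.

Fact Lspace_scaleDl x : {morph Lspace_scale^~ x : a b / a + b}.
Proof.
move=> a b /=; rewrite -[x]LreprK !Lclass_scale scalerDl.
exact: Lclass_is_additive.
Qed.

HB.instance Definition _ := GRing.Zmodule_isLmodule.Build R L
  Lspace_scaleA Lspace_scale1 Lspace_scaleDr Lspace_scaleDl.

Fact Lspace_normD (x y : L) :
  Lspace_norm (x + y) <= Lspace_norm x + Lspace_norm y.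
Proof.
rewrite -[x]LreprK -[y]LreprK -Lclass_is_additive !Lclass_norm.
exact: ler_LnormD.
Qed.

Fact Lspace_normZ (a : R) (x : L) :
  Lspace_norm (a *: x) = `|a| * Lspace_norm x.
Proof.
rewrite -[x]LreprK [_ *: _]Lclass_scale !Lclass_norm; apply: EFin_inj.
by rewrite EFinM !finite_norm_fine -LnormZ.
Qed.

Fact Lspace_norm0_eq0 (x : L) : Lspace_norm x = 0 -> x = 0.
Proof.
move=> x0; rewrite -[x]LreprK; apply: Lclass_eq.
exact: fine_Lnormr_eq0 x0.
Qed.

HB.instance Definition _ := Lmodule_isNormed.Build R L
  Lspace_normD Lspace_normZ Lspace_norm0_eq0.

End Lspace_normed.

Definition Lp01 (R : realType) (p : R) (p1 : 1 <= p) :=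
  LspaceType (mrestr (@lebesgue_measure R) (measurable_itv `]0%R, 1%R[))
    (p1 : (1 <= p%:E)%E).

(* [counting]-null sets are empty, so these are the p-summable sequences *)
Definition lp (R : realType) (p : R) (p1 : 1 <= p) :=
  LspaceType (@counting nat R) (p1 : (1 <= p%:E)%E).

Section Operators.
Variable R : realType.
Implicit Types V W E : normedModType R.

Definition closed_subspace V (X : set V) := submod_closed (mem X) /\ closed X.

(* [f] restricted to [X] is a homeomorphism onto its image; linearity of the
   inverse is automatic. *)
Definition isomorphism_on V W (X : set V) (f : {linear V -> W}) :=
  {within X, continuous f} /\
  exists2 g : W -> V, {within f @` X, continuous g} &
    forall x, X x -> g (f x) = x.

Definition isomorphic_to V (X : set V) E :=
  exists J : {linear E -> V}, isomorphism_on [set: E] J /\ range J = X.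

Definition strictly_singular E V W (T : {linear V -> W}) :=
  ~ exists Z : set V, [/\ closed_subspace Z, isomorphic_to Z E &
      isomorphism_on Z T].

Definition isomorphic_to_Hilbert V (X : set V) :=
  exists (H : completeNormedModType R) (dot : {dot H for idfun}),
    (forall x : H, `|x| ^+ 2 = dot x x) /\ isomorphic_to X H.

End Operators.

(* Main.v *)
From HB Require Import structures.
Require Import Defs.
From mathcomp Require Import all_boot all_order all_algebra.
From mathcomp Require Import all_classical all_reals all_analysis.
From mathcomp Require Import measurable_realfun ring lra.
From mathcomp Require finmap.

Set Implicit Arguments.
Unset Strict Implicit.
Unset Printing Implicit Defensive.

Import Order.TTheory GRing.Theory Num.Theory.
Import numFieldNormedType.Exports.
Local Open Scope classical_set_scope.
Local Open Scope ring_scope.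

(** Take independent symmetric spikes x_(i,n), equal to +-t_n with total
    probability t_n^-2 and to 0 otherwise, where t_n = 2^(r^n) grows very fast.
    They are orthonormal in L_2, while ||x_(i,n)||_p = t_n^(1-2/p) is tiny.  The
    operator T f = sum <f, x_(i,n)> x_(i,n+1) (plus the terms
    <f, x_(i,0)> x_(i,0), and stopped at a finite length l_i of each chain)
    shifts every chain one step up, so it fixes y_i = sum_(n <= l_i) x_(i,n);
    X is the space of all fixed points of T, on which T is the identity.

    Boundedness: an exponential moment estimate shows that the coefficients
    <f, x_(i,n)> of size at most 1/(2 t_n) are square summable (uniformly on the
    unit ball), and that on each level n the squares of all coefficients sum up
    to O(t_n^2).  The remaining coefficients of level n thus contribute at most
    O(t_n^3) ||x_(.,n+1)||_p, which is summable by the growth of t.  In other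
    words T f is a Hilbertian part plus an arbitrarily small one, so T cannot
    preserve the l_p-growth k^(1/p) of signed sums of k unit vectors: T is
    l_p-strictly singular.

    X is not Hilbertian: for k chains of length N, k large, the norm of every
    signed sum of the y_i is at least a multiple of sqrt (k N), by the same
    moment estimate, although the y_i are bounded. *)

(** * Choice of signs for quadratic forms *)

Lemma natr_unbounded (R : realType) (M : R) : exists N : nat, M < N%:R.
Proof. by exists (Num.truncn M).+1; rewrite real_truncnS_gt ?num_real. Qed.

(** Greedy choice: Q(U + v) and Q(U - v) average to Q(U) + Q(v), so one of the two signs does not
    exceed it. A general [Q] covers both Hilbert norms and the energy of finitely many coordinates
    of a sequence. *)
Lemma parallelogram_signs (R : realType) (V : lmodType R) (Q : V -> R)
    (k : nat) (v : nat -> V) :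
  Q 0 <= 0 -> (forall x y, Q (x + y) + Q (x - y) = 2 * (Q x + Q y)) ->
  exists e : nat -> bool,
    Q (\sum_(l < k) (-1) ^+ e l *: v l) <= \sum_(l < k) Q (v l).
Proof.
move=> Q0 QP; elim: k => [|k [e IH]]; first by exists xpred0; rewrite !big_ord0.
pose U := \sum_(l < k) (-1) ^+ e l *: v l.
suff [b Ub] : exists b : bool, Q (U + (-1) ^+ b *: v k) <= Q U + Q (v k).
  exists (fun l => if l == k then b else e l); rewrite !big_ord_recr/= eqxx.
  under eq_bigr => l _ do rewrite (ltn_eqF (ltn_ord l)).
  by rewrite (le_trans Ub)// lerD2r.
have := QP U (v k).
have [h _|h1 h2] := leP (Q (U + v k)) (Q U + Q (v k)).
  by exists false; rewrite expr0 scale1r.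
by exists true; rewrite expr1 scaleN1r; lra.
Qed.

(** * Operators f |-> sum_j phi_j(f) z_j *)

Section sampling_operator.
Context (R : realType) (L : normedModType R).
Variables (phi : nat -> L -> R) (z : nat -> L) (lev : nat -> nat)
  (t zeta tau : nat -> R) (C K : R).
Hypothesis phiP : forall j a u v, phi j (a *: u + v) = a * phi j u + phi j v.
Hypothesis C1 : 1 <= C.
Hypothesis K0 : 0 <= K.
Hypothesis lev_le : forall j, (lev j <= j)%N.
Hypothesis t1 : forall n, 1 <= t n.
Hypothesis phi_test : forall m (d : nat -> R) f,
  (forall j, `|d j| * t (lev j) <= 2^-1) -> \sum_(j < m) d j ^+ 2 <= 1 ->
  \sum_(j < m) d j * phi j f <= C * `|f|.
Hypothesis z_upper2 : forall m (d : nat -> R),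
  `|\sum_(j < m) d j *: z j| <= K * Num.sqrt (\sum_(j < m) d j ^+ 2).
Hypothesis zeta0 : forall n, 0 <= zeta n.
Hypothesis z_small : forall j, `|z j| <= zeta (lev j).
Hypothesis tau_tail : forall N M, \sum_(N <= n < M) t n ^+ 3 * zeta n <= tau N.

Let C0 : 0 < C. Proof. exact: lt_le_trans C1. Qed.
Let t0 n : 0 < t n. Proof. exact: lt_le_trans (t1 n). Qed.

(* The threshold below which [phi_test] applies to the coefficient itself. *)
Definition tame f j := `|phi j f| * t (lev j) <= 2^-1.
Definition sampling m f := \sum_(j < m) phi j f *: z j.

(** Self-testing: the tame coefficients, divided by the root of their own energy s, serve as test
    sequence in [phi_test], which then reads sqrt s <= C. For s > 1 this division only lowers them,
    so they stay below the threshold; for s <= 1 the bound follows from C >= 1. *)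
Lemma tame_sqr_sum m f : `|f| <= 1 ->
  \sum_(j < m | tame f j) phi j f ^+ 2 <= C ^+ 2.
Proof.
move=> f1; set s := \sum_(j < m | _) _.
have s0 : 0 <= s by apply: sumr_ge0 => *; exact: sqr_ge0.
have [s1|s1] := leP s 1; first by rewrite (le_trans s1)// expr_ge1// ltW.
have q1 : 1 <= Num.sqrt s by rewrite -sqrtr1 ler_wsqrtr// ltW.
have q0 : 0 < Num.sqrt s by apply: lt_le_trans q1.
pose d j := if tame f j then phi j f / Num.sqrt s else 0.
have : \sum_(j < m) d j * phi j f <= C * `|f|.
  apply: phi_test.
    move=> j; rewrite /d; case: ifPn => [fj|_]; last first.
      by rewrite normr0 mul0r invr_ge0.
    rewrite normrM normfV (gtr0_norm q0) mulrAC ler_pdivrMr//.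
    by rewrite (le_trans fj)// ler_peMr.
  rewrite (eq_bigr (fun j : 'I_m =>
      if tame f j then phi j f ^+ 2 * s^-1 else 0)); last first.
    move=> j _; rewrite /d; case: ifP => _; last by rewrite expr0n.
    by rewrite expr_div_n sqr_sqrtr.
  by rewrite -big_mkcond -mulr_suml mulfV// gt_eqF// (lt_trans _ s1).
rewrite (eq_bigr (fun j : 'I_m =>
    if tame f j then phi j f ^+ 2 * (Num.sqrt s)^-1 else 0)); last first.
  move=> j _; rewrite /d; case: ifP => _; last by rewrite mul0r.
  by rewrite mulrAC expr2.
rewrite -big_mkcond -mulr_suml -/s -{1}(sqr_sqrtr s0) expr2 mulfK ?gt_eqF//.
move=> h; have {}h : Num.sqrt s <= C by rewrite (le_trans h)// ler_piMr// ltW.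
by rewrite -(sqr_sqrtr s0) lerXn2r// nnegrE ?sqrtr_ge0// ltW.
Qed.

(** All thresholds on level n are equal, so dividing by 2 t_n sqrt s makes every coefficient of the
    level admissible in [phi_test], tame or not, at the cost of the factor 2 t_n. *)
Lemma level_sqr_sum m f n : `|f| <= 1 ->
  \sum_(j < m | lev j == n) phi j f ^+ 2 <= (2 * C * t n) ^+ 2.
Proof.
move=> f1; set s := \sum_(j < m | _) _.
have s0 : 0 <= s by apply: sumr_ge0 => *; exact: sqr_ge0.
have [->|sn0] := eqVneq s 0; first exact: sqr_ge0.
have sp : 0 < s by rewrite lt_neqAle eq_sym sn0.
have q0 : 0 < Num.sqrt s by rewrite sqrtr_gt0.
have tq0 : 0 < 2 * t n * Num.sqrt s by rewrite !mulr_gt0.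
(* [phi_test] asks for the threshold at every index, also beyond m, where s gives no control; hence
   the cut at m. *)
pose d j := if (lev j == n) && (j < m)%N then
  phi j f / (2 * t n * Num.sqrt s) else 0.
have : \sum_(j < m) d j * phi j f <= C * `|f|.
  apply: phi_test.
    move=> j; rewrite /d; case: ifPn => [/andP[/eqP jn jm]|_]; last first.
      by rewrite normr0 mul0r invr_ge0.
    rewrite jn normrM normfV (gtr0_norm tq0) mulrAC ler_pdivrMr//.
    rewrite mulrA mulrA mulVf// mul1r mulrC ler_pM2l//.
    rewrite -ler_sqr ?nnegrE ?sqrtr_ge0// sqr_sqrtr// real_normK ?num_real//.
    rewrite /s (bigD1 (Ordinal jm))/= ?jn//.
    by rewrite lerDl sumr_ge0// => *; exact: sqr_ge0.
  rewrite (eq_bigr (fun j : 'I_m =>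
      if lev j == n then phi j f ^+ 2 * (4 * t n ^+ 2 * s)^-1 else 0)).
    rewrite -big_mkcond -mulr_suml ler_pdivrMr ?mulr_gt0 ?exprn_gt0// mul1r.
    rewrite ler_peMl// (le_trans (_ : 1 <= 4))// ?ler1n// ler_peMr//.
    by rewrite expr_ge1// ltW.
  move=> j _; rewrite /d ltn_ord andbT; case: ifP => _; last by rewrite expr0n.
  rewrite expr_div_n !exprMn sqr_sqrtr//; congr (_ / (_ * _ * _)); ring.
rewrite (eq_bigr (fun j : 'I_m =>
    if lev j == n then phi j f ^+ 2 * (2 * t n * Num.sqrt s)^-1 else 0));
  last first.
  move=> j _; rewrite /d ltn_ord andbT; case: ifP => _; last by rewrite mul0r.
  by rewrite mulrAC expr2.
rewrite -big_mkcond -mulr_suml -/s -{1}(sqr_sqrtr s0) expr2 invfM mulrCA.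
rewrite mulfK ?gt_eqF// mulrC ler_pdivrMr ?mulr_gt0// => h.
rewrite -(sqr_sqrtr s0) lerXn2r// ?nnegrE ?sqrtr_ge0//.
  by rewrite !mulr_ge0// ltW.
rewrite (le_trans h)// [leRHS](_ : _ = C * 1 * (2 * t n)); last by ring.
by rewrite ler_pM2r ?mulr_gt0// ler_pM2l.
Qed.

(** A wild coefficient satisfies 1 < 2 t_n |phi_j(f)|, hence |phi_j(f)| <= 2 t_n phi_j(f)^2: the
    linear sum is dominated by the square sum of the level. *)
Lemma level_wild_sum m f n : `|f| <= 1 ->
  \sum_(j < m | (lev j == n) && ~~ tame f j) `|phi j f| * `|z j|
    <= 8 * C ^+ 2 * (t n ^+ 3 * zeta n).
Proof.
move=> f1; apply: (@le_trans _ _ (\sum_(j < m | lev j == n)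
    phi j f ^+ 2 * (2 * t n * zeta n))).
  rewrite [leRHS](bigID (fun j : 'I_m => ~~ tame f j))/=.
  apply: ler_wpDr.
    apply: sumr_ge0 => j _; apply: mulr_ge0; first exact: sqr_ge0.
    by rewrite !mulr_ge0// ltW.
  apply: ler_sum => j /andP[/eqP jn]; rewrite /tame -ltNge jn => fj.
  rewrite mulrA; apply: ler_pM => //; last by rewrite -jn.
  rewrite -(normr1 R) -real_normK ?num_real// expr2 -mulrA ler_peMr//.
  by rewrite normr1 mulrCA -ler_pdivrMl// mulr1 ltW.
rewrite -mulr_suml (le_trans (ler_wpM2r _ (level_sqr_sum m n f1)))//.
  by rewrite !mulr_ge0// ltW.
by rewrite le_eqVlt; apply/orP; left; apply/eqP; ring.
Qed.

Lemma wild_tail_sum N m f : `|f| <= 1 ->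
  \sum_(j < m | (N <= lev j)%N && ~~ tame f j) `|phi j f| * `|z j|
    <= 8 * C ^+ 2 * tau N.
Proof.
move=> f1; apply: le_trans (ler_wpM2l _ (tau_tail N m)); last first.
  by rewrite mulr_ge0// sqr_ge0.
rewrite mulr_sumr.
apply: le_trans (ler_sum _ (fun n _ => level_wild_sum m n f1)).
rewrite (exchange_big_dep (fun j : 'I_m => ~~ tame f j))/=; last first.
  by move=> ? ? _ /andP[].
rewrite big_mkcondl/=; apply: ler_sum => j fj; case: ifPn => Nj; last first.
  by apply: sumr_ge0 => *; rewrite mulr_ge0.
rewrite big_mkcond (bigD1_seq (lev j)) ?iota_uniq//=; last first.
  by rewrite mem_index_iota Nj (leq_ltn_trans (lev_le j)).
rewrite eqxx fj/= lerDl; apply: sumr_ge0 => i _.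
by case: ifP => // _; rewrite mulr_ge0.
Qed.

(** What is left out is wild and of level at least N, hence contributes O(tau N), while the energy
    kept grows with N. Not linear in f, because tameness depends on f. *)
Definition hilbert_part N f j :=
  if tame f j || (lev j < N)%N then phi j f else 0.
Definition hilbert_bound N := C ^+ 2 + \sum_(n < N) (2 * C * t n) ^+ 2.

Lemma hilbert_part_sqr_sum N m f : `|f| <= 1 ->
  \sum_(j < m) hilbert_part N f j ^+ 2 <= hilbert_bound N.
Proof.
move=> f1; have h := tame_sqr_sum m f1.
apply: (@le_trans _ _ (\sum_(j < m | tame f j) phi j f ^+ 2 +
    \sum_(j < m | (lev j < N)%N) phi j f ^+ 2)).
  rewrite [X in _ <= X + _]big_mkcond [X in _ <= _ + X]big_mkcond -big_split/=.
  apply: ler_sum => j _; rewrite /hilbert_part.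
  case: (tame f j) => /=; last by case: ifP => _; rewrite ?expr0n ?add0r.
  by rewrite lerDl; case: ifP => // _; exact: sqr_ge0.
apply: lerD => //.
apply: (@le_trans _ _ (\sum_(n < N) \sum_(j < m | lev j == n) phi j f ^+ 2)).
  rewrite (exchange_big_dep predT)//= big_mkcond; apply: ler_sum => j _.
  case: ifPn => jN; last by apply: sumr_ge0 => *; exact: sqr_ge0.
  rewrite (bigD1 (Ordinal jN))//= lerDl.
  by apply: sumr_ge0 => *; exact: sqr_ge0.
by apply: ler_sum => n _; exact: level_sqr_sum.
Qed.

Lemma sampling_hilbert_part N m f : `|f| <= 1 ->
  `|sampling m f - \sum_(j < m) hilbert_part N f j *: z j|
    <= 8 * C ^+ 2 * tau N.
Proof.
move=> f1; apply: le_trans (wild_tail_sum N m f1).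
rewrite /sampling -sumrB (le_trans (ler_norm_sum _ _ _))// [leRHS]big_mkcond.
apply: ler_sum => j _; rewrite /hilbert_part (leqNgt N) andbC -negb_or.
by case: ifPn; rewrite ?subrr ?normr0 ?scale0r ?subr0 ?normrZ.
Qed.

Lemma samplingP m a u v :
  sampling m (a *: u + v) = a *: sampling m u + sampling m v.
Proof.
rewrite /sampling scaler_sumr -big_split; apply: eq_bigr => j _.
by rewrite phiP scalerDl scalerA.
Qed.

Lemma phiZ j a f : phi j (a *: f) = a * phi j f.
Proof.
have p0 : phi j 0 = 0.
  have := phiP j 1 0 0; rewrite scaler0 addr0 mul1r => /eqP.
  by rewrite -subr_eq subrr => /eqP.
by have := phiP j a f 0; rewrite addr0 p0 addr0.
Qed.

Lemma samplingZ m a f : sampling m (a *: f) = a *: sampling m f.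
Proof.
by rewrite /sampling scaler_sumr; apply: eq_bigr => j _; rewrite phiZ scalerA.
Qed.

Definition sampling_bound := K * C + 8 * C ^+ 2 * tau 0.

Lemma sampling_bounded m f : `|sampling m f| <= sampling_bound * `|f|.
Proof.
(* Tameness is not homogeneous, so the estimate is made on the unit ball and extended by homogeneity
   of [sampling]. The cut N = 0 keeps exactly the tame coefficients. *)
have main g : `|g| <= 1 -> `|sampling m g| <= sampling_bound.
  move=> g1; rewrite -(subrK (\sum_(j < m) hilbert_part 0 g j *: z j)
    (sampling m g)) (le_trans (ler_normD _ _))// addrC.
  apply: lerD; last exact: sampling_hilbert_part.
  apply: (le_trans (z_upper2 _ _)); apply: ler_wpM2l => //.
  have := hilbert_part_sqr_sum 0 m g1; rewrite /hilbert_bound big_ord0 addr0.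
  move=> h; rewrite -[leRHS](gtr0_norm C0) -sqrtr_sqr.
  exact: ler_wsqrtr.
have [->|f0] := eqVneq f 0.
  by rewrite -(scale0r 0) samplingZ !scale0r normr0 mulr0.
have nf : 0 < `|f| by rewrite normr_gt0.
have := main (`|f|^-1 *: f); rewrite samplingZ !normrZ normfV normr_id.
by rewrite mulVf ?gt_eqF// lexx => /(_ isT); rewrite ler_pdivrMl// mulrC.
Qed.

Hypothesis L_complete : forall u : nat -> L,
  (forall e, 0 < e -> exists N, forall m n, (N <= m)%N -> (m <= n)%N ->
    `|u n - u m| <= e) -> exists l : L, u @ \oo --> l.

(** Tame and wild terms are summed separately: the squares of the tame coefficients are summable,
    which [z_upper2] turns into a Cauchy estimate in norm, and the wild terms converge
    absolutely. *)
Lemma sampling_cvg1 f : `|f| <= 1 ->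
  exists l : L, sampling m f @[m --> \oo] --> l.
Proof.
move=> f1; apply: L_complete => e e0.
pose a m := \sum_(j < m | tame f j) phi j f ^+ 2.
pose b m := \sum_(j < m | ~~ tame f j) `|phi j f| * `|z j|.
have incr (P : pred nat) (F : nat -> R) M : (forall j, 0 <= F j) ->
    (forall m, \sum_(j < m | P j) F j <= M) -> forall d, 0 < d ->
    exists N, forall m n, (N <= m)%N -> (m <= n)%N ->
    \sum_(j < n | P j) F j - \sum_(j < m | P j) F j <= d.
  move=> F0 FM d d0; pose s m := \sum_(j < m | P j) F j.
  have ns : nondecreasing_seq s.
    apply/nondecreasing_seqP => n; rewrite /s big_mkcond [leRHS]big_mkcond.
    by rewrite big_ord_recr/= lerDl; case: ifP.
  have cs : cvgn s.
    by apply: (nondecreasing_is_cvgn ns); exists M => _ [n _ <-]; exact: FM.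
  move/cvgrPdist_le : (cs) => /(_ d d0) [N _ hN].
  exists N => m n Nm mn; have hl := nondecreasing_cvgn_le ns cs n.
  have := hN m Nm; rewrite /= ler_norml => /andP[_]; rewrite -/(s n) -/(s m).
  by move=> h; apply: le_trans h; rewrite lerD2r.
(* [z_upper2] turns this tolerance into K e / (2 (K + 1)) <= e / 2; the summand 1 allows K = 0. *)
have [N1 h1] : exists N, forall m n, (N <= m)%N -> (m <= n)%N ->
    a n - a m <= (e / 2 / (K + 1)) ^+ 2.
  apply: (incr (tame f) (fun j => phi j f ^+ 2) (C ^+ 2)) => //.
  - by move=> j; exact: sqr_ge0.
  - by move=> m; exact: tame_sqr_sum.
  - by rewrite exprn_gt0// !divr_gt0// ltr_wpDl.
have [N2 h2] : exists N, forall m n, (N <= m)%N -> (m <= n)%N ->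
    b n - b m <= e / 2.
  apply: (incr (fun j => ~~ tame f j) (fun j => `|phi j f| * `|z j|)
    (8 * C ^+ 2 * tau 0)) => //.
  - by move=> m; exact: (wild_tail_sum 0 m f1).
  - by rewrite divr_gt0.
exists (maxn N1 N2) => m n; rewrite geq_max => /andP[N1m N2m] mn.
(* A difference of partial sums becomes a sum from 0 with vanishing first terms, the form in which
   [z_upper2] applies. *)
have split (V : zmodType) (F : nat -> V) : \sum_(j < n) F j - \sum_(j < m) F j
    = \sum_(j < n) (if (m <= j)%N then F j else 0).
  rewrite -!(big_mkord xpredT F) (@big_cat_nat _ _ _ m 0 n)//=.
  rewrite [LHS]addrAC subrr add0r.
  rewrite -(big_mkord xpredT (fun j => if (m <= j)%N then F j else 0)).
  rewrite (@big_cat_nat _ _ _ m 0 n)//= [X in _ = X + _]big1_seq ?add0r.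
    by apply: eq_big_nat => j /andP[->].
  by move=> j; rewrite mem_index_iota/= => jm; rewrite leqNgt jm.
pose d j := if (m <= j)%N && tame f j then phi j f else 0.
pose w j := if (m <= j)%N && ~~ tame f j then phi j f else 0.
have -> : sampling n f - sampling m f =
    \sum_(j < n) d j *: z j + \sum_(j < n) w j *: z j.
  rewrite /sampling (split _ (fun j => phi j f *: z j)) -big_split.
  apply: eq_bigr => j _ /=; rewrite /d /w.
  by case: (m <= j)%N; case: (tame f j); rewrite /= !scale0r ?add0r ?addr0.
rewrite (splitr e) (le_trans (ler_normD _ _))//; apply: lerD.
  apply: (le_trans (z_upper2 _ _)).
  have : \sum_(j < n) d j ^+ 2 <= (e / 2 / (K + 1)) ^+ 2.
    apply: le_trans (h1 _ _ N1m mn); rewrite /a.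
    rewrite [X in _ <= X - _]big_mkcond [X in _ <= _ - X]big_mkcond.
    have /= -> := split _ (fun j => if tame f j then phi j f ^+ 2 else 0).
    apply: ler_sum => j _; rewrite /d.
    by case: (m <= j)%N; case: (tame f j); rewrite /= ?expr0n.
  move=> /ler_wsqrtr; rewrite sqrtr_sqr ger0_norm; last first.
    by rewrite !divr_ge0// ?addr_ge0// ltW.
  move=> h; apply: (le_trans (ler_wpM2l K0 h)).
  have K1 : 0 < K + 1 by rewrite ltr_wpDl.
  rewrite mulrCA ler_piMr//; first by rewrite divr_ge0// ltW.
  by rewrite ler_pdivrMr// mul1r lerDl.
apply: le_trans (h2 _ _ N2m mn); rewrite /b.
rewrite [X in _ <= X - _]big_mkcond [X in _ <= _ - X]big_mkcond.
have /= -> := split _ (fun j => if ~~ tame f j then `|phi j f| * `|z j| else 0).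
rewrite (le_trans (ler_norm_sum _ _ _))//; apply: ler_sum => j _; rewrite /w.
by case: (m <= j)%N; case: (tame f j); rewrite /= ?scale0r ?normr0 ?normrZ.
Qed.

Lemma sampling_operator : exists T : {linear L -> L},
  (forall f, sampling m f @[m --> \oo] --> T f) /\
  (forall f, `|T f| <= sampling_bound * `|f|).
Proof.
have cv f : exists l : L, sampling m f @[m --> \oo] --> l.
  have [->|f0] := eqVneq f 0.
    exists 0; rewrite (_ : (fun m => _) = cst 0); first exact: cvg_cst.
    by apply/funext => m; rewrite -(scale0r 0) samplingZ !scale0r.
  have nf : 0 < `|f| by rewrite normr_gt0.
  have [|l hl] := @sampling_cvg1 (`|f|^-1 *: f).
    by rewrite normrZ normfV normr_id mulVf ?gt_eqF.
  exists (`|f| *: l); rewrite [X in X @ _](_ : _ =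
      (fun m => `|f| *: sampling m (`|f|^-1 *: f))).
    exact: (cvgZl_tmp hl).
  apply/funext => m.
  by rewrite samplingZ scalerA mulfV ?gt_eqF// scale1r.
pose T f := projT1 (cid (cv f)).
have Tf f : sampling m f @[m --> \oo] --> T f := projT2 (cid (cv f)).
have Tlin : linear T.
  move=> a u v; have h := Tf (a *: u + v).
  apply: (cvg_unique _ h); first exact: norm_hausdorff.
  rewrite (_ : (fun m => _) = (fun m => a *: sampling m u + sampling m v)).
    exact: (cvgD (cvgZl_tmp (Tf u)) (Tf v)).
  by apply/funext => m; rewrite samplingP.
pose T' : {linear L -> L} := HB.pack T (GRing.isLinear.Build R L L _ T Tlin).
exists T'; split => // f.
apply: (cvgr_to_le (cvg_norm (Tf f))).
by apply: nearW => m; exact: sampling_bounded.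
Qed.

(** Up to wild terms T passes through square summable sequences, where suitable signs make energies
    subadditive; hence the growth sqrt k. The signs are chosen on the coefficient sequences
    [hilbert_part N (e l)], since [hilbert_part] is not linear in its vector argument. *)
Lemma sampling_signs (T : {linear L -> L}) (k N : nat) (e : nat -> L) :
  (forall f, sampling m f @[m --> \oo] --> T f) -> (forall l, `|e l| <= 1) ->
  exists s : nat -> bool, `|T (\sum_(l < k) (-1) ^+ s l *: e l)| <=
    1 + k%:R * (8 * C ^+ 2 * tau N) +
    K * Num.sqrt (k%:R * hilbert_bound N).
Proof.
move=> Tf e1.
(* One partial sum approximates all k limits; the tolerance 1 / (k + 1) makes the k errors add up to
   at most 1. *)
have [m hm] : exists m, forall l : 'I_k,
    `|T (e l) - sampling m (e l)| <= k.+1%:R^-1.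
  suff : \forall m \near \oo, forall l : 'I_k,
      `|T (e l) - sampling m (e l)| <= k.+1%:R^-1.
    by move=> [m _ hm]; exists m => l; apply: (hm m) => /=.
  apply: filter_forall => l; move/cvgrPdist_le : (Tf (e l)); apply.
  by rewrite invr_gt0.
pose Q (v : nat -> R) := \sum_(j < m) v j ^+ 2.
have [||s hs] := @parallelogram_signs R (nat -> R) Q k
    (fun l => hilbert_part N (e l)).
- by rewrite /Q big1// => j _; rewrite expr0n.
- move=> x y; rewrite /Q -!big_split mulr_sumr; apply: eq_bigr => j _ /=.
  by rewrite !fctE; ring.
exists s.
have {}hs : Q (\sum_(l < k) (-1) ^+ s l *: hilbert_part N (e l)) <=
    k%:R * hilbert_bound N.
  apply: (le_trans hs); rewrite mulr_natl -[X in _ *+ X](card_ord k).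
  rewrite -sumr_const; apply: ler_sum => l _.
  exact: hilbert_part_sqr_sum.
(* Three parts: error of the partial sums, wild remainder, Hilbertian part. *)
have -> : T (\sum_(l < k) (-1) ^+ s l *: e l) =
    \sum_(l < k) (-1) ^+ s l *: (T (e l) - sampling m (e l)) +
    \sum_(l < k) (-1) ^+ s l *:
      (sampling m (e l) - \sum_(j < m) hilbert_part N (e l) j *: z j) +
    \sum_(l < k) (-1) ^+ s l *: \sum_(j < m) hilbert_part N (e l) j *: z j.
  rewrite linear_sum -!big_split; apply: eq_bigr => l _ /=.
  by rewrite linearZ/= -!scalerDr !addrA !subrK.
have sgn (l : 'I_k) (v : L) : `|(-1) ^+ s l *: v| = `|v|.
  by rewrite normrZ normrX normrN1 expr1n mul1r.
apply: (le_trans (ler_normD _ _)); apply: lerD.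
  apply: (le_trans (ler_normD _ _)); apply: lerD.
    apply: (le_trans (ler_norm_sum _ _ _)).
    apply: (@le_trans _ _ (\sum_(l < k) k.+1%:R^-1)).
      by apply: ler_sum => l _; rewrite sgn.
    rewrite sumr_const card_ord -[_ *+ k]mulr_natl ler_pdivrMr// mul1r ler_nat.
    exact: leqnSn.
  apply: (le_trans (ler_norm_sum _ _ _)).
  rewrite mulr_natl -[X in _ *+ X](card_ord k) -sumr_const.
  by apply: ler_sum => l _; rewrite sgn sampling_hilbert_part.
rewrite (_ : \sum_(l < k) _ = \sum_(j < m)
    (\sum_(l < k) (-1) ^+ s l *: hilbert_part N (e l)) j *: z j).
  apply: (le_trans (z_upper2 _ _)); apply: ler_wpM2l => //.
  exact: ler_wsqrtr.
under eq_bigr do rewrite scaler_sumr.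
rewrite exchange_big; apply: eq_bigr => j _; rewrite fct_sumE scaler_suml.
by apply: eq_bigr => l _; rewrite scalerA.
Qed.

End sampling_operator.

(** * Completeness of L_p *)

Lemma half_geometric_sum (R : realType) (N M : nat) :
  \sum_(N <= k < M) 2^-1 ^+ k <= 2 * 2^-1 ^+ N :> R.
Proof.
have [MN|/ltnW NM] := leqP M N.
  by rewrite big_geq// mulr_ge0// exprn_ge0// invr_ge0.
suff -> : \sum_(N <= k < M) 2^-1 ^+ k = 2 * 2^-1 ^+ N - 2 * 2^-1 ^+ M :> R.
  by rewrite gerBl mulr_ge0// exprn_ge0// invr_ge0.
rewrite -(subnKC NM); elim: (M - N)%N => [|n IH].
  by rewrite addn0 big_geq// subrr.
by rewrite addnS big_nat_recr ?leq_addr//= IH exprS; field.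
Qed.

Section Lspace_integral.
Context d (T : measurableType d) (R : realType).
Context (mu : {measure set T -> \bar R}) (p : R) (p1 : (1 <= p%:E)%E).
Local Notation L := (LspaceType mu p1).
Local Notation pmoment f := (\int[mu]_t (`|f t| `^ p)%:E)%E.

Let p0 : 0 < p. Proof. by move: p1; rewrite lee_fin; exact: lt_le_trans. Qed.

Lemma measurable_Lrepr (x : L) : measurable_fun setT (Lrepr x : T -> R).
Proof. exact: measurable_funPT. Qed.

Lemma measurable_normr_powR (f : T -> R) : measurable_fun setT f ->
  measurable_fun setT (fun t => (`|f t| `^ p)%:E).
Proof.
move=> mf; apply/measurable_EFinP.
apply: (measurableT_comp (measurable_powR p)).
exact: measurableT_comp.
Qed.

Lemma ae_eq_pmoment (f g : T -> R) : measurable_fun setT f ->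
  measurable_fun setT g -> f = g %[ae mu] -> pmoment f = pmoment g.
Proof.
move=> mf mg fg; apply: ge0_ae_eq_integral => //.
- exact: measurable_normr_powR.
- exact: measurable_normr_powR.
- by apply: filterS fg => t /= h tT; rewrite h.
Qed.

Lemma pmoment_Lrepr (x : L) : pmoment (Lrepr x) = (`|x| `^ p)%:E.
Proof.
rewrite -[`|x|]/(Lspace_norm x) /Lspace_norm -poweR_EFin finite_norm_fine.
by rewrite powR_Lnorm ?gt_eqF//; apply: eq_integral => t _; rewrite -poweR_EFin.
Qed.

Lemma Lspace_of_pmoment (f : T -> R) :
  measurable_fun setT f -> (pmoment f < +oo)%E ->
  exists x : L, (Lrepr x : T -> R) = f %[ae mu] /\ pmoment f = (`|x| `^ p)%:E.
Proof.
move=> mf ff.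
have fL : f \in Lfun mu p%:E.
  apply/andP; split; rewrite inE//= /finite_norm.
  by rewrite (@lty_poweRy _ _ p) ?gt_eqF// powR_Lnorm ?gt_eqF.
pose f2 : LfunType mu p1 := Lfun_Sub p1 fL.
exists (Lclass f2); have h : (Lrepr (Lclass f2) : T -> R) = f %[ae mu].
  exact: Lrepr_class f2.
split=> //; rewrite -pmoment_Lrepr; apply: ae_eq_pmoment => //.
exact: ae_eq_sym.
Qed.

Lemma Lrepr_lin (a : R) (x y : L) :
  (Lrepr (a *: x + y) : T -> R) = (fun t => a * Lrepr x t + Lrepr y t) %[ae mu].
Proof.
have -> : a *: x + y = Lclass (a *: Lrepr x + Lrepr y).
  by rewrite Lclass_is_additive LreprK.
exact: Lrepr_class.
Qed.

Lemma Lrepr_sub (x y : L) :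
  (Lrepr (x - y) : T -> R) = (fun t => Lrepr x t - Lrepr y t) %[ae mu].
Proof.
have := Lrepr_lin (-1) y x; rewrite scaleN1r addrC.
by apply: filterS => t /= h tT; rewrite h// mulN1r addrC.
Qed.

Lemma powR_le_cancel (x y : R) : 0 <= x -> 0 <= y -> x `^ p <= y `^ p -> x <= y.
Proof.
move=> x0 y0; apply: contraTT; rewrite -!ltNge => yx.
by apply: gt0_ltr_powR.
Qed.

End Lspace_integral.

Section Riesz_Fischer.
Context d (T : measurableType d) (R : realType).
Context (mu : {measure set T -> \bar R}) (p : R) (p1 : (1 <= p%:E)%E).
Local Notation L := (LspaceType mu p1).
Local Notation pmoment f := (\int[mu]_t (`|f t| `^ p)%:E)%E.

Let p0 : 0 < p. Proof. by move: p1; rewrite lee_fin; exact: lt_le_trans. Qed.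

(** The increments are at most M^(1/p) q^k with q = 2^(-1/p) < 1. Applied pointwise, with M the sum
    of all 2^k |u_(k+1) - u_k|^p. *)
Lemma geometric_powR_cvg (u : nat -> R) (M : R) :
  (forall k, 2 ^+ k * `|u k.+1 - u k| `^ p <= M) -> cvgn u.
Proof.
move=> uM; pose q := 2^-1 `^ p^-1 : R.
have q1 : `|q| < 1.
  have e1 : 1 `^ p^-1 = 1 :> R by rewrite powR1.
  rewrite ger0_norm ?powR_ge0// -e1 gt0_ltr_powR ?invr_gt0 ?nnegrE//.
  by rewrite invf_lt1// ltr1n.
have M0 : 0 <= M by apply: le_trans (uM 0%N); rewrite mulr_ge0 ?powR_ge0.
have du k : `|u k.+1 - u k| <= geometric (M `^ p^-1) q k.
  rewrite /geometric/=.
  have h : `|u k.+1 - u k| `^ p <= M * 2^-1 ^+ k.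
    by rewrite exprVn ler_pdivlMr ?exprn_gt0// mulrC.
  have hk : (`|u k.+1 - u k| `^ p) `^ p^-1 <= (M * 2^-1 ^+ k) `^ p^-1.
    have Mk : 0 <= M * 2^-1 ^+ k by rewrite mulr_ge0// exprn_ge0// invr_ge0.
    by apply: ge0_ler_powR; rewrite ?invr_ge0 ?nnegrE ?powR_ge0//; exact: ltW.
  move: hk; rewrite -powRrM mulfV ?gt_eqF// powRr1// powRM// /q.
  rewrite -(@powR_mulrn _ 2^-1 k) ?invr_ge0// powRAC.
  by rewrite powR_mulrn ?powR_ge0.
have cv : cvgn (series (telescope u)).
  apply: normed_cvg; apply: series_le_cvg (is_cvg_geometric_series q1).
  - by move=> n; exact: normr_ge0.
  - by move=> n; exact: le_trans (du n).
  - exact: du.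
rewrite (_ : u = fun n => u 0%N + series (telescope u) n).
  by apply: is_cvgD => //; exact: is_cvg_cst.
by apply/funext => n; rewrite -eq_sum_telescope.
Qed.

Lemma limn_einf_le (u : nat -> \bar R) (c : \bar R) (N : nat) :
  (forall n, (N <= n)%N -> (u n <= c)%E) -> (limn_einf u <= c)%E.
Proof.
move=> uc; rewrite limn_einf_lim; apply: lime_le; first exact: is_cvg_einfs.
apply: nearW => n; apply: (@le_trans _ _ (u (maxn N n))); last first.
  by apply: uc; exact: leq_maxl.
by apply: ereal_inf_lbound; exists (maxn N n) => //=; exact: leq_maxr.
Qed.

Lemma cvg_powR (u : nat -> R) (l : R) : (forall n, 0 <= u n) -> 0 <= l ->
  u @ \oo --> l -> (u n) `^ p @[n --> \oo] --> l `^ p.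
Proof.
(* Derivability of the power gives continuity at l > 0; at l = 0 the tolerance e^(1/p) is used
   directly. *)
move=> u0; rewrite le_eqVlt => /predU1P[<-|l0] ul.
  rewrite powR0 ?gt_eqF//; apply/cvgrPdist_le => e e0.
  have ep : 0 < e `^ p^-1 by rewrite powR_gt0.
  move/cvgrPdist_le : ul => /(_ _ ep); apply: filterS => n.
  rewrite !sub0r !normrN ger0_norm// ger0_norm ?powR_ge0// => un.
  have := ge0_ler_powR (ltW p0) _ _ un; rewrite !nnegrE => /(_ (u0 n) (ltW ep)).
  by rewrite -powRrM mulVf ?gt_eqF// powRr1// ltW.
have cl : {for l, continuous (@powR R ^~ p)}.
  apply: differentiable_continuous; apply/derivable1_diffP.
  by apply: derivable_powR; rewrite in_itv/= l0.
exact: (cvg_comp _ _ ul cl).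
Qed.

Lemma limn_einf_ge0 (u : nat -> \bar R) :
  (forall n, (0 <= u n)%E) -> (0 <= limn_einf u)%E.
Proof.
move=> u0; rewrite limn_einf_lim; apply: lime_ge; first exact: is_cvg_einfs.
by apply: nearW => n; apply: le_ereal_inf_tmp => _ [k _ <-].
Qed.

(* Riesz-Fischer: a fast Cauchy subsequence converges almost everywhere, and
   Fatou's lemma identifies its pointwise limit as the limit in norm. *)
Lemma Lspace_complete (u : nat -> L) :
  (forall e, 0 < e -> exists N, forall m n, (N <= m)%N -> (m <= n)%N ->
    `|u n - u m| <= e) -> exists l : L, u @ \oo --> l.
Proof.
move=> cu; have cu4 k : exists N, forall m n, (N <= m)%N -> (m <= n)%N ->
    `|u n - u m| <= 4^-1 ^+ k by apply: cu; rewrite exprn_gt0.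
have [N0 hN0] := choice cu4.
(* Partial sums make the subsequence monotone and keep it above [N0]. *)
pose N k := (\sum_(i < k.+1) N0 i)%N.
have N0N k : (N0 k <= N k)%N by rewrite /N big_ord_recr leq_addl.
have NS k : (N k <= N k.+1)%N by rewrite /N [leqRHS]big_ord_recr leq_addr.
have NM j k : (j <= k)%N -> (N j <= N k)%N.
  by move=> /subnK <-; elim: (k - j)%N => // i IH; exact: leq_trans (NS _).
have hN k n : (N k <= n)%N -> `|u n - u (N k)| <= 4^-1 ^+ k.
  by move=> kn; exact: hN0.
pose g k : T -> R := Lrepr (u (N k)).
have mg k : measurable_fun setT (g k) by exact: measurable_Lrepr.
have mgB j k : measurable_fun setT (fun t => g j t - g k t).
  exact: measurable_funB.
have pg j k : (k <= j)%N ->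
    (pmoment (fun t => (g j t - g k t)%R) <= ((4^-1 ^+ k) `^ p)%:E)%E.
  move=> kj; have h := Lrepr_sub (u (N j)) (u (N k)).
  rewrite -(@ae_eq_pmoment _ _ _ mu p _ _ _ _ h).
  - rewrite pmoment_Lrepr lee_fin ge0_ler_powR ?nnegrE ?exprn_ge0 ?(ltW p0)//.
    by apply: hN; exact: NM.
  - exact: measurable_Lrepr.
  - exact: mgB.
(* As p >= 1, the p-th moment of the k-th increment is at most 4^-k. The weight 2^k still leaves
   integrals at most 2^-k, so the weighted series has integral at most 2 and is finite almost
   everywhere. *)
pose w k t := (2 ^+ k * `|g k.+1 t - g k t| `^ p)%:E.
have mw k : measurable_fun setT (w k).
  apply/measurable_EFinP; apply: measurable_funM => //.
  by have /measurable_EFinP := measurable_normr_powR p (mgB k.+1 k).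
have w0 k t : (0 <= w k t)%E by rewrite lee_fin mulr_ge0 ?powR_ge0.
have wint k : (\int[mu]_t w k t <= (2^-1 ^+ k)%:E)%E.
  rewrite /w; under eq_integral do rewrite EFinM.
  rewrite ge0_integralZl_EFin ?exprn_ge0//; last exact: measurable_normr_powR.
  apply: (@le_trans _ _ ((2 ^+ k)%:E * (4^-1 ^+ k)%:E)%E).
    apply: lee_wpmul2l; first by rewrite lee_fin exprn_ge0.
    apply: (le_trans (pg _ _ (leqnSn k))); rewrite lee_fin.
    apply: ge1r_powR; last by move: p1; rewrite lee_fin.
    by rewrite exprn_gt0//= exprn_ile1// invf_le1// ler1n.
  rewrite -EFinM lee_fin -exprMn (_ : 2 * 4^-1 = 2^-1)//.
  by rewrite -[4]/((2 * 2)%:R) natrM invfM mulrA mulfV ?mul1r.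
pose S t := (\sum_(0 <= k <oo) w k t)%E.
have mS : measurable_fun setT S by exact: ge0_emeasurable_sum.
have Sint : (\int[mu]_t S t < +oo)%E.
  rewrite integral_nneseries//.
  apply: (@le_lt_trans _ _ (2 : R)%:E); last exact: ltry.
  apply: lime_le; first by apply: is_cvg_nneseries => *; exact: integral_ge0.
  apply: nearW => n.
  apply: (@le_trans _ _ (\sum_(0 <= k < n) (2^-1 ^+ k)%:E)%E).
    by apply: lee_sum => k _; exact: wint.
  rewrite sumEFin lee_fin (le_trans (half_geometric_sum R 0 n))//.
  by rewrite expr0 mulr1.
have S0 t : (0 <= S t)%E by exact: nneseries_ge0.
have iS : mu.-integrable setT S.
  apply/integrableP; split => //.
  by under eq_integral => t _ do rewrite gee0_abs//.
have cvae : {ae mu, forall t, cvgn (fun k => g k t)}.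
  have := integrable_ae measurableT iS; apply: filterS => t /(_ I) St.
  apply: (@geometric_powR_cvg _ (fine (S t))) => k.
  rewrite -lee_fin fineK//; apply: le_trans (nneseries_lim_ge k.+1 _) => //.
  by rewrite big_nat_recr//= leeDr// sume_ge0.
(* The upper limit is measurable and agrees with the limit wherever that exists; [fine] yields 0
   where it is infinite. *)
pose f t := fine (limn_esup (fun k => (g k t)%:E)).
have mf : measurable_fun setT f.
  apply: (measurableT_comp (fine_measurable measurableT)).
  by apply: measurable_fun_limn_esup => k; exact/measurable_EFinP.
have fl : {ae mu, forall t, g k t @[k --> \oo] --> f t}.
  apply: filterS cvae => t ct; rewrite /f.
  have h : (g k t)%:E @[k --> \oo] --> (limn (fun k => g k t))%:E.
    by apply: cvg_EFin => //; exact: nearW.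
  by rewrite (cvg_limn_einf_sup h).2.
have fg k : (pmoment (fun t => (f t - g k t)%R) <= ((4^-1 ^+ k) `^ p)%:E)%E.
  pose a j t := (`|g j t - g k t| `^ p)%:E.
  have ma j : measurable_fun setT (a j) by exact: measurable_normr_powR.
  have a0 j t : (0 <= a j t)%E by rewrite lee_fin powR_ge0.
  have -> : pmoment (fun t => (f t - g k t)%R) =
      (\int[mu]_t limn_einf (a^~ t))%E.
    apply: ge0_ae_eq_integral => //.
    - by apply: measurable_normr_powR; exact: measurable_funB.
    - rewrite (_ : (fun t => _) = (fun t => - limn_esup (fun j => - a j t))%E).
        apply: measurableT_comp => //; apply: measurable_fun_limn_esup => j.
        exact: measurableT_comp.
      by apply/funext => t; rewrite -limn_einfN; congr limn_einf;
        apply/funext => j; exact/esym/oppeK.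
    - by move=> t _; apply: limn_einf_ge0.
    - apply: filterS fl => t ft _; apply/esym.
      apply: (fun h => (@cvg_limn_einf_sup _ _ _ h).1).
      apply: cvg_EFin; first exact: nearW.
      apply: cvg_powR => //; apply: cvg_norm.
      by apply: cvgB => //; exact: cvg_cst.
  apply: (le_trans (fatou mu measurableT ma _)) => //.
  by apply: (limn_einf_le (N := k)) => j kj; exact: pg.
(* Fatou bounds the moment of f - g_0, so this difference is turned into a class and u (N 0) is
   added back. *)
have [||x [xf px]] := @Lspace_of_pmoment _ _ _ mu p p1 (fun t => f t - g 0%N t).
- exact: measurable_funB.
- by apply: le_lt_trans (fg 0%N) _; exact: ltry.
exists (x + u (N 0%N)).
have xk k : `|x + u (N 0%N) - u (N k)| <= 4^-1 ^+ k.
  apply: (powR_le_cancel p1); rewrite ?exprn_ge0//.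
  rewrite -lee_fin -pmoment_Lrepr; apply: le_trans (fg k).
  rewrite le_eqVlt; apply/orP; left; apply/eqP.
  apply: ae_eq_pmoment => //; first exact: measurable_funB.
  have h1 := Lrepr_sub (x + u (N 0%N)) (u (N k)).
  have h2 := Lrepr_lin 1 x (u (N 0%N)); rewrite scale1r in h2.
  apply: filterS3 h1 h2 xf => t /= h1 h2 h3 tT.
  by rewrite h1// h2// h3// mul1r subrK.
apply/cvgrPdist_le => e e0.
have [k ke] : exists k, 4^-1 ^+ k <= e / 2 :> R.
  have : (4^-1 : R) ^+ k @[k --> \oo] --> 0.
    by apply: cvg_expr; rewrite ger0_norm// invf_lt1// ltr1n.
  have e2 : 0 < e / 2 by rewrite divr_gt0.
  move=> /cvgrPdist_le /(_ _ e2) [k _ hk]; exists k.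
  by have := hk k (leqnn k); rewrite /= sub0r normrN ger0_norm// exprn_ge0.
exists (N k) => // n /= Nn.
rewrite -(subrK (u (N k)) (x + u (N 0%N))) -addrA (splitr e).
apply: (le_trans (ler_normD _ _)); apply: lerD; first exact: le_trans ke.
by rewrite distrC; apply: le_trans ke; exact: hN.
Qed.

End Riesz_Fischer.

(** * Independent spikes *)

Section grid_mean.
Context (R : realType).
Implicit Types (F H : nat -> R).

Definition grid_mean K F := K%:R^-1 * \sum_(a < K) F a.

(** Quotient and remainder by D run through all pairs exactly once: this is the source of all
    independence below. *)
Lemma grid_mean_prod K D F H : (0 < D)%N ->
  grid_mean (K * D) (fun a => F (a %/ D)%N * H (a %% D)%N) =
  grid_mean K F * grid_mean D H.
Proof.
move=> D0; rewrite /grid_mean natrM invfM mulrACA; congr (_ * _).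
elim: K => [|K IH]; first by rewrite mul0n !big_ord0 mul0r.
rewrite big_ord_recr/= mulrDl -IH mulSnr big_split_ord/=; congr (_ + _).
rewrite mulr_sumr; apply: eq_bigr => i _ /=.
by rewrite divnMDl// divn_small// addn0 modnMDl modn_small.
Qed.

Lemma grid_meanD K F H :
  grid_mean K (fun a => F a + H a) = grid_mean K F + grid_mean K H.
Proof. by rewrite /grid_mean big_split mulrDr. Qed.

Lemma grid_meanZ K c F : grid_mean K (fun a => c * F a) = c * grid_mean K F.
Proof. by rewrite /grid_mean -mulr_sumr mulrCA. Qed.

Lemma grid_mean_cst K c : (0 < K)%N -> grid_mean K (fun=> c) = c.
Proof.
move=> K0; rewrite /grid_mean sumr_const card_ord -(mulr_natl c) mulKf//.
by rewrite pnatr_eq0 -lt0n.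
Qed.

Lemma eq_grid_mean H K F :
  (forall a, F a = H a) -> grid_mean K F = grid_mean K H.
Proof. by move=> FH; congr (_ * _); apply: eq_bigr. Qed.
Arguments eq_grid_mean H {K F}.

(* [b] and [-b] each for one out of the [2 * b ^ 2] digits, [0] for the others:
   mean 0 and variance 1. *)
Definition spike (b a : nat) : R :=
  if a == 0%N then b%:R else if a == 1%N then - b%:R else 0.

Lemma grid_mean_spike b (h : R -> R) : (0 < b)%N ->
  grid_mean (2 * b ^ 2) (fun a => h (spike b a)) =
  h 0 + (h b%:R + h (- b%:R) - 2 * h 0) / (2 * b%:R ^+ 2).
Proof.
move=> b0; have [D hD] : exists D, (2 * b ^ 2 = D.+2)%N.
  have : (1 < 2 * b ^ 2)%N by rewrite leq_pmulr// expn_gt0 b0.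
  by case: (2 * b ^ 2)%N => [//|[//|D _]]; exists D.
have hR : 2 * b%:R ^+ 2 = D.+2%:R :> R by rewrite -hD natrM natrX.
rewrite /grid_mean hD hR !big_ord_recl/= (eq_bigr (fun=> h 0))//.
rewrite sumr_const card_ord.
rewrite -(mulr_natl (h 0)) -[D.+2]addn2 natrD.
have : D%:R + 2 != 0 :> R by rewrite -(natrD _ D 2) pnatr_eq0 addn2.
by move=> ?; field.
Qed.

(** exp(u) <= 1 / (1 - u), used for u and -u, bounds the sum by 2 / (1 - u^2), and u^2 <= 1/4. *)
Lemma expR_addN_le (u : R) : `|u| <= 2^-1 ->
  expR u + expR (- u) <= 2 + 4 * u ^+ 2.
Proof.
move=> u2; have := u2; rewrite ler_norml => /andP[ul ur].
have up : 0 < 1 - u by lra.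
have um : 0 < 1 + u by lra.
have h1 : expR u <= (1 - u)^-1.
  by rewrite -[u in expR u]opprK expRN lef_pV2 ?posrE ?expR_gt0// expR_ge1Dx.
have h2 : expR (- u) <= (1 + u)^-1.
  by rewrite expRN lef_pV2 ?posrE ?expR_gt0// expR_ge1Dx.
apply: (le_trans (lerD h1 h2)).
have -> : (1 - u)^-1 + (1 + u)^-1 = 2 / ((1 - u) * (1 + u)).
  by field; rewrite !gt_eqF.
rewrite ler_pdivrMr ?mulr_gt0//.
have u4 : u ^+ 2 <= 4^-1.
  rewrite -real_normK ?num_real// (_ : 4^-1 = 2^-1 ^+ 2); last by field.
  by rewrite lerXn2r// nnegrE.
have := sqr_ge0 u; nra.
Qed.

(** The spike is nonzero with probability b^-2, which cancels the b^2 in (d b)^2: the mean is at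
    most 1 + 2 d^2, whatever the height b. *)
Lemma grid_mean_expR_spike b d : (0 < b)%N -> `|d| * b%:R <= 2^-1 ->
  grid_mean (2 * b ^ 2) (fun a => expR (d * spike b a)) <= expR (2 * d ^+ 2).
Proof.
move=> b0 db; rewrite (grid_mean_spike (fun s => expR (d * s)))//.
apply: le_trans (expR_ge1Dx _); rewrite mulr0 expR0 lerD2l.
have bp : 0 < b%:R :> R by rewrite ltr0n.
rewrite ler_pdivrMr ?mulr_gt0 ?exprn_gt0// mulrN.
have := @expR_addN_le (d * b%:R); rewrite normrM (ger0_norm (ltW bp)).
by move=> /(_ db); rewrite exprMn; lra.
Qed.

Variable b : nat -> nat.
Hypothesis b0 : forall j, (0 < b j)%N.

Definition radix j := (2 * b j ^ 2)%N.
(* The cells of the [mesh m] grid are indexed by the first [m] digits in the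
   mixed radix system [radix]; the digits are independent, and the [j]-th spike
   depends on the [j]-th digit only. *)
Definition mesh m := (\prod_(j < m) radix j)%N.

Lemma radix_gt0 j : (0 < radix j)%N.
Proof. by rewrite muln_gt0/= expn_gt0 b0. Qed.

Lemma mesh_gt0 m : (0 < mesh m)%N.
Proof. by apply: prodn_gt0 => j; exact: radix_gt0. Qed.

Lemma meshS m : mesh m.+1 = (mesh m * radix m)%N.
Proof. by rewrite /mesh big_ord_recr. Qed.

(** The newest digit is the least significant: the quotient by [radix m'] is the enclosing cell of
    the coarser mesh, the remainder is the digit itself. *)
Fixpoint spike_sum (d : nat -> R) m a : R :=
  if m is m'.+1 then spike_sum d m' (a %/ radix m')%N +
    d m' * spike (b m') (a %% radix m')%N else 0.

Lemma grid_mean_spike_sum d m : grid_mean (mesh m) (spike_sum d m) = 0.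
Proof.
elim: m => [|m IH]; first by rewrite grid_mean_cst// mesh_gt0.
rewrite meshS /=.
rewrite (grid_meanD _ (fun a => spike_sum d m (a %/ radix m)%N)).
rewrite (eq_grid_mean (fun a => spike_sum d m (a %/ radix m)%N *
  (fun=> 1) (a %% radix m)%N)); last by move=> a; rewrite mulr1.
rewrite (grid_mean_prod _ (spike_sum d m) (fun=> 1)) ?radix_gt0//.
rewrite IH mul0r add0r.
rewrite (eq_grid_mean (fun a => (fun=> d m) (a %/ radix m)%N *
  spike (b m) (a %% radix m)%N))//.
rewrite (grid_mean_prod _ (fun=> d m) (spike (b m))) ?radix_gt0//.
rewrite (grid_mean_spike id)// addrN mulr0 subr0 mul0r add0r.
by rewrite mulr0.
Qed.

(** Orthonormality: in the expansion, each mixed term factors by independence into means one of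
    which is 0, and a squared spike has mean 1. *)
Lemma grid_mean_spike_sumM d d' m :
  grid_mean (mesh m) (fun a => spike_sum d m a * spike_sum d' m a) =
  \sum_(j < m) d j * d' j.
Proof.
elim: m => [|m IH].
  by rewrite big_ord0 (eq_grid_mean (fun=> 0)) ?grid_mean_cst ?mesh_gt0//
    => a; rewrite mul0r.
rewrite meshS big_ord_recr -IH /=.
rewrite (eq_grid_mean (fun a =>
  spike_sum d m (a %/ radix m)%N * spike_sum d' m (a %/ radix m)%N *
    (fun=> 1) (a %% radix m)%N +
  (spike_sum d m (a %/ radix m)%N * (d' m * spike (b m) (a %% radix m)%N) +
  (spike_sum d' m (a %/ radix m)%N * (d m * spike (b m) (a %% radix m)%N) +
  (fun=> d m * d' m) (a %/ radix m)%N * (spike (b m) (a %% radix m)%N ^+ 2)))));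
  last by move=> a; ring.
rewrite !grid_meanD; congr (_ + _).
  have /= -> := grid_mean_prod (mesh m)
    (fun a => spike_sum d m a * spike_sum d' m a) (fun=> 1) (radix_gt0 m).
  by rewrite grid_mean_cst ?radix_gt0// mulr1.
have /= -> := grid_mean_prod (mesh m) (spike_sum d m)
  (fun a => d' m * spike (b m) a) (radix_gt0 m).
have /= -> := grid_mean_prod (mesh m) (spike_sum d' m)
  (fun a => d m * spike (b m) a) (radix_gt0 m).
rewrite !grid_mean_spike_sum !mul0r !add0r.
have /= -> := grid_mean_prod (mesh m) (fun=> d m * d' m)
  (fun a => spike (b m) a ^+ 2) (radix_gt0 m).
rewrite grid_mean_cst ?mesh_gt0// (grid_mean_spike (fun s => s ^+ 2))//.
have bp : b m != 0%N :> nat by rewrite -lt0n.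
have bp' : (b m)%:R != 0 :> R by rewrite pnatr_eq0.
rewrite sqrrN expr0n/=; field.
exact: bp'.
Qed.

(** Independence multiplies the exponential moments; below the thresholds, sums of spikes are thus
    as concentrated as Gaussian ones. *)
Lemma grid_mean_expR_spike_sum d m : (forall j, `|d j| * (b j)%:R <= 2^-1) ->
  grid_mean (mesh m) (fun a => expR (spike_sum d m a)) <=
  expR (2 * \sum_(j < m) d j ^+ 2).
Proof.
move=> db; elim: m => [|m IH].
  by rewrite /= big_ord0 mulr0 grid_mean_cst// mesh_gt0.
rewrite meshS big_ord_recr/= mulrDr expRD.
rewrite (eq_grid_mean (fun a => expR (spike_sum d m (a %/ radix m)%N) *
    expR (d m * spike (b m) (a %% radix m)%N))); last first.
  by move=> a; rewrite expRD.
have /= -> := grid_mean_prod (mesh m) (fun a => expR (spike_sum d m a))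
  (fun a => expR (d m * spike (b m) a)) (radix_gt0 m).
apply: ler_pM => //; last exact: grid_mean_expR_spike.
  by rewrite /grid_mean mulr_ge0 ?invr_ge0// sumr_ge0// => *; exact: expR_ge0.
by rewrite /grid_mean mulr_ge0 ?invr_ge0// sumr_ge0// => *; exact: expR_ge0.
Qed.

End grid_mean.

(** * Spikes as functions on a probability space *)

Section equipartition.
Context d (T : measurableType d) (R : realType).
Variables (mu : {measure set T -> \bar R}) (grid : nat -> T -> nat).
Hypothesis mu1 : mu [set: T] = 1%E.
Hypothesis measurable_grid_eq : forall K n, measurable [set t | grid K t = n].
Hypothesis mu_grid_eq : forall K a, (0 < K)%N -> (a < K)%N ->
  mu [set t | grid K t = a] = (K%:R^-1)%:E.
Hypothesis ae_grid_ltn :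
  forall K, (0 < K)%N -> {ae mu, forall t, (grid K t < K)%N}.
Hypothesis grid_divn :
  forall K D t, (0 < D)%N -> (grid (K * D) t %/ D)%N = grid K t.

Lemma measurable_grid_fun K (F : nat -> R) :
  measurable_fun [set: T] (fun t => F (grid K t)).
Proof.
move=> _ Y mY; rewrite setTI.
have -> : (fun t => F (grid K t)) @^-1` Y =
    \bigcup_(n in F @^-1` Y) [set t | grid K t = n].
  apply/seteqP; split => [t Yt|t [n Yn /= tn]]; first by exists (grid K t).
  by rewrite /preimage/= tn.
by apply: bigcup_measurable => n _; exact: measurable_grid_eq.
Qed.

Lemma bounded_integrable (f : T -> R) M : measurable_fun setT f ->
  (forall t, `|f t| <= M) -> mu.-integrable setT (EFin \o f).
Proof.
move=> mf fM; apply: measurable_bounded_integrable => //.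
  by rewrite mu1 ltry.
exists M; split; first exact: num_real.
by move=> x xM t _ /=; rewrite (le_trans (fM t))// ltW.
Qed.

Lemma integral_grid K (F : nat -> R) : (0 < K)%N ->
  (\int[mu]_t (F (grid K t))%:E)%E = (grid_mean K F)%:E.
Proof.
move=> K0; have Kp : 0 < K%:R :> R by rewrite ltr0n.
pose A a := [set t : T | grid K t = a].
have mA a : measurable (A a) by exact: measurable_grid_eq.
have iA (a : 'I_K) : mu.-integrable setT (fun t => (F a * \1_(A a) t)%:E).
  apply: (@bounded_integrable _ `|F a|).
    by apply: measurable_funM => //; exact: measurable_indic.
  by move=> t; rewrite normrM ler_piMr// indicE; case: (_ \in _);
    rewrite ?normr1 ?normr0.
transitivity (\int[mu]_t (\sum_(a < K) (F a * \1_(A a) t)%:E)%E)%E.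
  apply: ae_eq_integral => //.
  - exact/measurable_EFinP/measurable_grid_fun.
  - by apply: emeasurable_sum => a; exact: measurable_int (iA a).
  apply: filterS (ae_grid_ltn K0) => t tK _.
  rewrite sumEFin; congr (_%:E); rewrite (bigD1 (Ordinal tK))//=.
  rewrite indicE mem_set// mulr1 big1 ?addr0// => a /negP aK.
  rewrite indicE memNset ?mulr0// => h; apply: aK; apply/eqP/val_inj.
  exact/esym.
rewrite integral_sum// /grid_mean mulr_sumr -sumEFin; apply: eq_bigr => a _.
under eq_integral do rewrite EFinM.
rewrite integralZl//; last first.
  apply: (@bounded_integrable _ 1); first exact: measurable_indic.
  by move=> t; rewrite indicE; case: (_ \in _); rewrite ?normr1 ?normr0.
by rewrite integral_indic// setIT mu_grid_eq// -EFinM mulrC.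
Qed.


Variable b : nat -> nat.
Hypothesis b0 : forall j, (0 < b j)%N.
Variable p : R.
Hypothesis p1 : 1 < p.
Hypothesis p2 : p <= 2.
Variable pE : (1 <= p%:E)%E.
Local Notation L := (LspaceType mu pE).

Let p0 : 0 < p. Proof. exact: lt_trans p1. Qed.
Let pn0 : p != 0. Proof. by rewrite gt_eqF. Qed.

(** [mesh b j.+1] is the coarsest mesh that determines digit j, as its last digit. *)
Definition spike_fun j t : R :=
  spike R (b j) (grid (mesh b j.+1) t %% radix b j)%N.

Lemma spike_sum_grid (c : nat -> R) m t :
  spike_sum b c m (grid (mesh b m) t) = \sum_(j < m) c j * spike_fun j t.
Proof.
elim: m => [|m IH]; first by rewrite big_ord0.
rewrite big_ord_recr/= -IH /spike_fun; congr (_ + _).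
by rewrite meshS grid_divn// radix_gt0.
Qed.

Lemma spike_fun_le j t : `|spike_fun j t| <= (b j)%:R.
Proof.
rewrite /spike_fun /spike; case: ifP => _; first by rewrite ger0_norm.
by case: ifP => _; rewrite ?normrN ?normr0// ger0_norm.
Qed.

Lemma measurable_spike_fun j : measurable_fun setT (spike_fun j).
Proof.
exact: (measurable_grid_fun _ (fun a => spike R (b j) (a %% radix b j)%N)).
Qed.

Lemma spike_sum_le (c : nat -> R) m a : `|spike_sum b c m a| <=
  \sum_(j < m) `|c j| * (b j)%:R.
Proof.
elim: m a => [|m IH] a /=; first by rewrite big_ord0 normr0.
rewrite big_ord_recr/= (le_trans (ler_normD _ _))// lerD// normrM ler_wpM2l//.
rewrite /spike; case: ifP => _; first by rewrite ger0_norm.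
by case: ifP => _; rewrite ?normrN ?normr0// ger0_norm.
Qed.

Lemma pmoment_spike_fun j :
  (\int[mu]_t (`|spike_fun j t| `^ p)%:E)%E =
  ((b j)%:R `^ p / (b j)%:R ^+ 2)%:E.
Proof.
have := integral_grid (fun a => `|spike R (b j) (a %% radix b j)%N| `^ p)
  (mesh_gt0 b0 j.+1) => ->; congr (_%:E).
rewrite meshS.
have := grid_mean_prod (mesh b j) (fun=> 1)
  (fun a => `|spike R (b j) a| `^ p) (radix_gt0 b0 j).
rewrite grid_mean_cst ?mesh_gt0// mul1r => h.
transitivity (grid_mean (radix b j) (fun a => `|spike R (b j) a| `^ p)).
  by rewrite -h; apply: eq_grid_mean => a; rewrite mul1r.
rewrite (grid_mean_spike (fun s : R => `|s| `^ p))// normr0 powR0// normrN.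
rewrite ger0_norm// mulr0 subr0 add0r.
have bj : (b j)%:R != 0 :> R by rewrite pnatr_eq0 -lt0n.
by field.
Qed.

Lemma spike_class : exists X : nat -> L, forall j,
  (Lrepr (X j) : T -> R) = spike_fun j %[ae mu] /\
  `|X j| `^ p = (b j)%:R `^ p / (b j)%:R ^+ 2.
Proof.
suff /choice[X hX] : forall j, exists x : L,
    (Lrepr x : T -> R) = spike_fun j %[ae mu] /\
    `|x| `^ p = (b j)%:R `^ p / (b j)%:R ^+ 2 by exists X.
move=> j; have [||x [x1 x2]] := @Lspace_of_pmoment _ _ _ mu p pE (spike_fun j).
- exact: measurable_spike_fun.
- by rewrite pmoment_spike_fun ltry.
by exists x; split=> //; apply: EFin_inj; rewrite -x2 pmoment_spike_fun.
Qed.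

(** Meant for bounded s: over a probability measure f is integrable, so the product is too. *)
Definition pairing (f : L) (s : T -> R) : R := \int[mu]_t (Lrepr f t * s t).

Lemma Lrepr_integrable (f : L) : mu.-integrable setT (EFin \o Lrepr f).
Proof.
apply/Lfun1_integrable.
apply: (@Lfun_subset _ _ _ mu 1%E p%:E) => //; first by rewrite mu1.
exact: LfunP.
Qed.

Lemma pairing_integrable (f : L) (s : T -> R) M : measurable_fun setT s ->
  (forall t, `|s t| <= M) ->
  mu.-integrable setT (EFin \o (fun t => Lrepr f t * s t)).
Proof.
move=> ms sM.
apply: (eq_integrable measurableT ((EFin \o Lrepr f) \* (EFin \o s))%E) => //.
apply: integrableMl => //; first exact: Lrepr_integrable.
exists M; split; first exact: num_real.
by move=> x xM t _ /=; rewrite (le_trans (sM t))// ltW.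
Qed.

Lemma pairingP a (u v : L) (s : T -> R) M :
  measurable_fun setT s -> (forall t, `|s t| <= M) ->
  pairing (a *: u + v) s = a * pairing u s + pairing v s.
Proof.
move=> ms sM; have iu := pairing_integrable u ms sM.
have iv := pairing_integrable v ms sM.
rewrite /pairing -RintegralZl// -RintegralD//; last first.
  exact: (integrableZl measurableT a iu).
congr fine; apply: ae_eq_integral => //.
- exact: measurable_int (pairing_integrable _ ms sM).
- apply/measurable_EFinP; apply: measurable_funD.
    apply: measurable_funM => //; apply/measurable_EFinP.
    exact: measurable_int iu.
  by apply/measurable_EFinP; exact: measurable_int iv.
apply: filterS (Lrepr_lin a u v) => t /= h tT.
by rewrite h// mulrDl mulrA.
Qed.

Definition spike_coef j (f : L) := pairing f (spike_fun j).

Lemma spike_coefP j a u v :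
  spike_coef j (a *: u + v) = a * spike_coef j u + spike_coef j v.
Proof. exact: pairingP (measurable_spike_fun j) (spike_fun_le j). Qed.

Lemma spike_coef_sum (c : nat -> R) m f : \sum_(j < m) c j * spike_coef j f =
  pairing f (fun t => spike_sum b c m (grid (mesh b m) t)).
Proof.
rewrite /pairing; under eq_Rintegral do rewrite spike_sum_grid.
elim: m => [|m IH].
  rewrite big_ord0; under eq_Rintegral do rewrite big_ord0 mulr0.
  by rewrite Rintegral_cst// mul0r.
have im : mu.-integrable setT (EFin \o
    (fun t => Lrepr f t * \sum_(j < m) c j * spike_fun j t)).
  apply: (@pairing_integrable _ _ (\sum_(j < m) `|c j| * (b j)%:R)).
    apply: measurable_sum => j; apply: measurable_funM => //.
    exact: measurable_spike_fun.
  by move=> t; rewrite -spike_sum_grid spike_sum_le.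
have ij := pairing_integrable f (measurable_spike_fun m) (spike_fun_le m).
rewrite big_ord_recr/= IH /spike_coef /pairing -RintegralZl// -RintegralD//.
  by apply: eq_Rintegral => t _; rewrite big_ord_recr/= mulrDr mulrCA.
exact: (integrableZl measurableT (c m) ij).
Qed.

(** A spike can be read on any finer mesh, so two spikes become functions of the same cell and their
    product is handled by [grid_mean_spike_sumM]. *)
Lemma spike_fun_delta j m t : (j < m)%N ->
  spike_fun j t = spike_sum b (fun i => (i == j)%:R) m (grid (mesh b m) t).
Proof.
move=> jm; rewrite spike_sum_grid (bigD1 (Ordinal jm))//= eqxx mul1r.
by rewrite big1 ?addr0// => i /negPf ij; rewrite (_ : _ == _ = false)// mul0r.
Qed.

Lemma spike_coef_class (X : nat -> L) :
  (forall j, (Lrepr (X j) : T -> R) = spike_fun j %[ae mu]) ->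
  forall j k, spike_coef k (X j) = (j == k)%:R.
Proof.
move=> hX j k; pose m := (maxn j k).+1.
have jm : (j < m)%N by rewrite ltnS leq_maxl.
have km : (k < m)%N by rewrite ltnS leq_maxr.
rewrite /spike_coef /pairing /Rintegral.
rewrite (@ae_eq_integral _ _ _ mu setT
    (fun t => (spike_fun j t * spike_fun k t)%:E))//.
- under eq_integral do rewrite (spike_fun_delta _ jm) (spike_fun_delta _ km).
  have := integral_grid (fun a => spike_sum b (fun i => (i == j)%:R) m a *
    spike_sum b (fun i => (i == k)%:R) m a) (mesh_gt0 b0 m) => -> /=.
  rewrite grid_mean_spike_sumM// (bigD1 (Ordinal jm))//= eqxx mul1r.
  by rewrite big1 ?addr0// => i /negPf ij; rewrite (_ : _ == _ = false)// mul0r.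
- have := pairing_integrable (X j) (measurable_spike_fun k) (spike_fun_le k).
  exact: measurable_int.
- by apply/measurable_EFinP/measurable_funM; exact: measurable_spike_fun.
- by apply: filterS (hX j) => t h tT; congr (_ * _)%:E; exact: h.
Qed.

Lemma Lrepr_spike_sum (X : nat -> L) :
  (forall j, (Lrepr (X j) : T -> R) = spike_fun j %[ae mu]) ->
  forall (c : nat -> R) m, (Lrepr (\sum_(j < m) c j *: X j) : T -> R) =
    (fun t => spike_sum b c m (grid (mesh b m) t)) %[ae mu].
Proof.
move=> hX c; elim=> [|m IH].
  rewrite big_ord0; have := Lrepr_sub (0 : L) 0; rewrite subrr.
  by apply: filterS => t h tT; rewrite h// subrr.
have -> : \sum_(j < m.+1) c j *: X j = c m *: X m + \sum_(j < m) c j *: X j.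
  by rewrite big_ord_recr addrC.
have hl := Lrepr_lin (c m) (X m) (\sum_(j < m) c j *: X j).
apply: filterS3 (hX m) IH hl => t h1 h2 h3 tT.
rewrite [LHS](h3 tT) (h2 tT) (h1 tT).
rewrite -[RHS]/(spike_sum b c m.+1 (grid (mesh b m.+1) t)).
by rewrite !spike_sum_grid big_ord_recr/= addrC.
Qed.

(** For p <= 2 one has |F|^p <= 1 + F^2, whose mean is at most 2 <= 2^p when the energy is at most
    1. Homogeneity gives the general case. *)
Lemma spike_upper2 (X : nat -> L) :
  (forall j, (Lrepr (X j) : T -> R) = spike_fun j %[ae mu]) ->
  forall m (c : nat -> R), `|\sum_(j < m) c j *: X j| <=
    2 * Num.sqrt (\sum_(j < m) c j ^+ 2).
Proof.
move=> hX; have main m (c : nat -> R) : \sum_(j < m) c j ^+ 2 <= 1 ->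
    `|\sum_(j < m) c j *: X j| <= 2.
  move=> c1; apply: (powR_le_cancel pE) => //; rewrite -lee_fin -pmoment_Lrepr.
  pose F a := spike_sum b c m a.
  rewrite (@ae_eq_pmoment _ _ _ mu p _ (fun t => F (grid (mesh b m) t)))//;
    first last.
  - exact: Lrepr_spike_sum.
  - exact: measurable_grid_fun.
  rewrite (integral_grid (fun a => `|F a| `^ p)) ?mesh_gt0// lee_fin.
  apply: (@le_trans _ _ (grid_mean (mesh b m) (fun a => 1 + F a * F a))).
    apply: ler_wpM2l; first by rewrite invr_ge0.
    apply: ler_sum => a _; have [F1|/ltW F1] := leP `|F a| 1.
      have := ge0_ler_powR (ltW p0) _ _ F1; rewrite !nnegrE => /(_ _ _).
      rewrite powR1 => h; apply: (le_trans (h _ _)) => //.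
      by rewrite lerDl -expr2 sqr_ge0.
    apply: (le_trans (ler_powR F1 p2)).
    rewrite powR_mulrn// real_normK ?num_real//.
    by rewrite expr2 lerDr.
  rewrite grid_meanD grid_mean_cst ?mesh_gt0// grid_mean_spike_sumM//.
  apply: (@le_trans _ _ 2); last by rewrite le1r_powR ?ler1n// ltW.
  rewrite (_ : 2 = 1 + 1)// lerD2l; apply: le_trans c1.
  by apply: ler_sum => j _; rewrite expr2.
move=> m c; set v := \sum_(j < m) c j ^+ 2.
have v0 : 0 <= v by apply: sumr_ge0 => *; exact: sqr_ge0.
have [vz|vn] := eqVneq v 0.
  rewrite vz sqrtr0 mulr0 big1 ?normr0// => j _.
  have := psumr_eq0P (fun i _ => sqr_ge0 (c (val i))) vz.
  by move=> /(_ j isT) /eqP; rewrite sqrf_eq0 => /eqP ->; rewrite scale0r.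
have sv : 0 < Num.sqrt v by rewrite sqrtr_gt0 lt_neqAle eq_sym vn.
have := main m (fun j => c j / Num.sqrt v).
have -> : \sum_(j < m) (c j / Num.sqrt v) ^+ 2 = 1.
  under eq_bigr do rewrite expr_div_n sqr_sqrtr//.
  by rewrite -mulr_suml mulfV.
move=> /(_ (lexx _)).
have -> : \sum_(j < m) (c j / Num.sqrt v) *: X j =
    (Num.sqrt v)^-1 *: \sum_(j < m) c j *: X j.
  by rewrite scaler_sumr; apply: eq_bigr => j _; rewrite scalerA mulrC.
rewrite normrZ ger0_norm ?invr_ge0 ?sqrtr_ge0//.
by rewrite ler_pdivrMl// mulrC.
Qed.

Lemma spike_sumN (c : nat -> R) m a :
  spike_sum b (fun j => - c j) m a = - spike_sum b c m a.
Proof.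
by elim: m a => [|m IH] a /=; rewrite ?oppr0// IH opprD mulNr.
Qed.

Let q := p / (p - 1).
Definition test_bound := 1 + q `^ q * (expR 2 + expR 2).

Lemma test_bound_ge1 : 1 <= test_bound.
Proof. by rewrite lerDl mulr_ge0 ?powR_ge0// addr_ge0// expR_ge0. Qed.

(** Young's inequality with the conjugate exponents p and q; then |s|/q <= exp(|s|/q), raised to the
    power q, trades |s|^q for an exponential. *)
Lemma young_expR (x s : R) :
  `|x * s| <= `|x| `^ p + q `^ q * (expR s + expR (- s)).
Proof.
have p10 : 0 < p - 1 by rewrite subr_gt0.
have q1 : 1 <= q by rewrite ler_pdivlMr// mul1r gerBl.
have q0 : 0 < q by exact: lt_le_trans q1.
have pq : p^-1 + q^-1 = 1 by rewrite /q; field; rewrite pn0 gt_eqF.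
rewrite normrM.
apply: (le_trans (conjugate_powR (normr_ge0 x) (normr_ge0 s) p0 q0 pq)).
apply: lerD; first by rewrite ler_pdivrMr// ler_peMr ?powR_ge0// ltW.
apply: (@le_trans _ _ (`|s| `^ q)).
  by rewrite ler_pdivrMr// ler_peMr ?powR_ge0.
apply: (@le_trans _ _ (q `^ q * expR `|s|)).
  have h : `|s| / q <= expR (`|s| / q).
    by apply: le_trans (expR_ge1Dx _); rewrite lerDr.
  have e1 : expR (`|s| / q) `^ q = expR `|s|.
    by rewrite /powR gt_eqF ?expR_gt0// expRK mulrC divfK ?gt_eqF.
  have := ge0_ler_powR (ltW q0) _ _ h; rewrite !nnegrE expR_ge0.
  have sq0 : 0 <= `|s| / q by rewrite divr_ge0// ltW.
  rewrite sq0 e1 => /(_ isT isT) h1.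
  rewrite -[X in X `^ q <= _](@divfK _ q) ?gt_eqF// powRM ?(ltW q0)//.
  by rewrite mulrC ler_wpM2l ?powR_ge0.
rewrite ler_wpM2l ?powR_ge0//.
by case: (ger0P s) => _; rewrite ?lerDl ?lerDr expR_ge0.
Qed.

(** On the unit ball, integrate [young_expR] with s the sum of spikes: the exponential moments of s
    and -s are at most exp(2). The bound is uniform in m and in the heights. *)
Lemma spike_test m (c : nat -> R) f : (forall j, `|c j| * (b j)%:R <= 2^-1) ->
  \sum_(j < m) c j ^+ 2 <= 1 ->
  \sum_(j < m) c j * spike_coef j f <= test_bound * `|f|.
Proof.
move=> cb c1; rewrite spike_coef_sum; set s := fun t => spike_sum _ _ _ _.
have ms : measurable_fun setT s by exact: measurable_grid_fun.
have sM t : `|s t| <= \sum_(j < m) `|c j| * (b j)%:R by exact: spike_sum_le.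
have main g : `|g| <= 1 -> pairing g s <= test_bound.
  move=> g1; have ig := pairing_integrable g ms sM.
  have mg : measurable_fun setT (Lrepr g) by exact: measurable_Lrepr.
  have mgs : measurable_fun setT (fun t => Lrepr g t * s t).
    exact: measurable_funM.
  apply: (le_trans (ler_norm _)).
  apply: (le_trans (le_normr_Rintegral _ ig)) => //.
  pose Q := q `^ q.
  have Q0 : 0 <= Q by exact: powR_ge0.
  have mE : measurable_fun setT (fun t => (Q * (expR (s t) + expR (- s t)))%:E).
    apply/measurable_EFinP; exact: (measurable_grid_fun _ (fun a =>
      Q * (expR (spike_sum b c m a) + expR (- spike_sum b c m a)))).
  have H : (\int[mu]_t (`|Lrepr g t * s t|%R)%:E <= test_bound%:E)%E.
    apply: (@le_trans _ _ (\int[mu]_t ((`|Lrepr g t| `^ p)%:E +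
        (Q * (expR (s t) + expR (- s t)))%:E))%E).
      apply: ge0_le_integral => //.
      - by apply/measurable_EFinP/measurableT_comp.
      - by apply: emeasurable_funD => //; exact: measurable_normr_powR.
      - by move=> t _; rewrite -EFinD lee_fin young_expR.
    rewrite ge0_integralD//; [|exact: measurable_normr_powR|]; last first.
      by move=> t _; rewrite lee_fin mulr_ge0// addr_ge0// expR_ge0.
    rewrite pmoment_Lrepr [X in (_ + X)%E](_ : _ =
      (grid_mean (mesh b m) (fun a =>
        Q * (expR (spike_sum b c m a) + expR (- spike_sum b c m a))))%:E);
      last first.
      exact: (integral_grid (fun a =>
        Q * (expR (spike_sum b c m a) + expR (- spike_sum b c m a)))
        (mesh_gt0 b0 m)).
    rewrite -EFinD lee_fin; apply: lerD.
      have := ge0_ler_powR (ltW p0) _ _ g1; rewrite !nnegrE => /(_ _ _).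
      by rewrite powR1; exact.
    rewrite grid_meanZ grid_meanD ler_wpM2l//; apply: lerD.
      apply: (le_trans (grid_mean_expR_spike_sum b0 m cb)).
      by rewrite ler_expR ler_piMr.
    have cb' j : `|- c j| * (b j)%:R <= 2^-1 by rewrite normrN.
    have := @grid_mean_expR_spike_sum R b b0 (fun j => - c j) m cb'.
    under eq_bigr do rewrite sqrrN.
    rewrite (@eq_grid_mean R (fun a => expR (- spike_sum b c m a))); last first.
      by move=> a; rewrite spike_sumN.
    by move=> h; apply: (le_trans h); rewrite ler_expR ler_piMr.
  rewrite -lee_fin fineK//.
  rewrite ge0_fin_numE; last by apply: integral_ge0 => t _; rewrite lee_fin.
  by apply: le_lt_trans H _; exact: ltry.
have pZ a g : pairing (a *: g) s = a * pairing g s.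
  have := pairingP 1 0 0 ms sM; rewrite scaler0 addr0 mul1r => /eqP.
  rewrite -[X in X == _]addr0 (inj_eq (addrI _)) => /eqP h0.
  by have := pairingP a g 0 ms sM; rewrite addr0 -h0 addr0.
have [->|f0] := eqVneq f 0.
  by rewrite -(scale0r 0) pZ !(scale0r, normr0, mul0r, mulr0).
have nf : 0 < `|f| by rewrite normr_gt0.
have := main (`|f|^-1 *: f); rewrite normrZ normfV normr_id mulVf ?gt_eqF//.
by rewrite pZ lexx => /(_ isT); rewrite ler_pdivrMl// mulrC.
Qed.

End equipartition.

(** * Equal cells of the unit interval *)

Section unit_interval_grid.
Context (R : realType).
Local Notation mu := (mrestr (@lebesgue_measure R) (measurable_itv `]0%R, 1%R[)).

(** [Num.truncn] vanishes at negative reals, which makes cell 0 exceptional in [grid_eq]. *)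
Definition grid (K : nat) (t : R) : nat := Num.truncn (K%:R * t).

Lemma grid_leq K t n : (grid K t <= n)%N = (K%:R * t < n.+1%:R).
Proof. by rewrite /grid real_truncn_le_nat// num_real. Qed.

Lemma grid_eq K t n :
  (grid K t == n) = ((n == 0%N) || (n%:R <= K%:R * t)) && (K%:R * t < n.+1%:R).
Proof.
rewrite eqn_leq grid_leq andbC; congr (_ && _).
by case: n => [//|n]; rewrite ltnNge grid_leq -leNgt.
Qed.

(** Nested integer parts: either side is at most n exactly when K t < n + 1. *)
Lemma grid_divn K D t : (0 < D)%N -> (grid (K * D) t %/ D)%N = grid K t.
Proof.
move=> D0; have Dp : 0 < D%:R :> R by rewrite ltr0n.
have h n : (grid (K * D) t %/ D <= n)%N = (grid K t <= n)%N.
  rewrite -ltnS ltn_divLR// -(@prednK (n.+1 * D)) ?muln_gt0// ltnS.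
  rewrite !grid_leq prednK ?muln_gt0// !natrM mulrAC ltr_pM2r//.
by apply/eqP; rewrite eqn_leq h leqnn -h leqnn.
Qed.

Lemma measurable_grid_eq K n : measurable [set t : R | grid K t = n].
Proof.
have mK : measurable_fun [set: R] (fun t : R => K%:R * t).
  exact: measurable_funM.
have -> : [set t : R | grid K t = n] = (fun t : R => K%:R * t) @^-1`
    [set` if n == 0%N then `]-oo, (n.+1%:R : R)[ else `[(n%:R : R), n.+1%:R[].
  apply/seteqP; split => t /=.
    move/eqP; rewrite grid_eq => /andP[h1 h2].
    by move: h1; case: ifP => /= n0 h1; rewrite in_itv/= ?h1 h2.
  move=> h; apply/eqP; rewrite grid_eq; move: h.
  by case: ifP => /= _; rewrite in_itv/=.
rewrite -[X in measurable X]setTI; apply: mK => //.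
Qed.

Lemma mu_grid_eq K a : (0 < K)%N -> (a < K)%N ->
  mu [set t | grid K t = a] = (K%:R^-1)%:E.
Proof.
move=> K0 aK; have Kp : 0 < K%:R :> R by rewrite ltr0n.
(* Cut to the open unit interval, cell 0 loses its left endpoint; the other cells keep theirs. *)
have -> : mu [set t | grid K t = a] = lebesgue_measure
    [set` Interval (BSide (a != 0%N) (a%:R / K%:R))
      (BLeft (a.+1%:R / K%:R : R))].
  rewrite  /mrestr; congr (lebesgue_measure _); apply/seteqP; split => t /=.
    move=> [/eqP]; rewrite grid_eq !in_itv/= => /andP[h1 h2] /andP[t0 t1].
    rewrite ltr_pdivlMr// [t * _]mulrC h2 andbT.
    case: eqP h1 => [->|_] /=; first by rewrite mul0r.
    by rewrite ler_pdivrMr// mulrC.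
  rewrite !in_itv/= ltr_pdivlMr// [t * _]mulrC => /andP[h1 h2]; split.
    apply/eqP; rewrite grid_eq h2 andbT; move: h1.
    by case: eqP => //= _; rewrite ler_pdivrMr// mulrC.
  apply/andP; split.
    move: h1; case: eqP => [->|/eqP a0] /=; first by rewrite mul0r.
    by apply: lt_le_trans; rewrite divr_gt0// ltr0n lt0n.
  rewrite -(ltr_pM2l Kp) mulr1 (lt_le_trans h2)//.
  by rewrite ler_nat.
rewrite lebesgue_measure_itv/= lte_fin ltr_pM2r ?invr_gt0// ltr_nat ltnSn.
by rewrite -EFinB -mulrBl -natrB// subSnn mul1r.
Qed.

Lemma mu_unit : mu [set: R] = 1%E.
Proof.
rewrite  /mrestr setTI lebesgue_measure_itv/= lte_fin ltr01.
by rewrite sube0.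
Qed.

Lemma ae_grid_ltn K : (0 < K)%N -> {ae mu, forall t, (grid K t < K)%N}.
Proof.
move=> K0; exists (~` `]0, 1[); split.
- exact: measurableC.
- by rewrite /mrestr setICl measure0.
- move=> t /=; apply: contra_not; rewrite in_itv/= => /andP[t0 t1].
  rewrite -{2}(prednK K0) ltnS grid_leq prednK// gtr_pMr//.
  by rewrite ltr0n.
Qed.

End unit_interval_grid.

(** * Isomorphic invariants *)

Section isomorphism_bounds.
Context (R : realType) (V W : normedModType R).

(** Continuity of the inverse at 0 gives a radius e with |x| < 1 whenever |f x| < e; rescaling x so
    that |f x| = e / 2 yields the constant e / 2. *)
Lemma isomorphism_on_lower (X : set V) (f : {linear V -> W}) :
  X 0 -> (forall a x, X x -> X (a *: x)) -> isomorphism_on X f ->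
  exists2 a, 0 < a & forall x, X x -> a * `|x| <= `|f x|.
Proof.
move=> X0 XZ [_ [g cg gK]].
have g0 : g 0 = 0 by rewrite -(linear0 f) gK.
have fX0 : (f @` X) 0 by exists 0 => //; exact: linear0.
have cg0 : g @ within (f @` X) (nbhs (0 : W)) --> g 0.
  by move/subspace_continuousP : cg; apply.
move: cg0; rewrite g0 => /cvgrPdist_lt /(_ 1 ltr01) /=.
rewrite /prop_near1 /nbhs/= /within/= => /nbhs_norm0P [e /= e0 he].
exists (e / 2); first by rewrite divr_gt0.
move=> x Xx; have [fx0|fx0] := eqVneq (f x) 0.
  by rewrite -(gK _ Xx) fx0 g0 !normr0 mulr0.
have nf : 0 < `|f x| by rewrite normr_gt0.
pose c := e / 2 / `|f x|.
have c0 : 0 < c by rewrite !divr_gt0.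
have Xc : X (c *: x) by exact: XZ.
have : `|0 - g (f (c *: x))| < 1.
  apply: he; last by exists (c *: x).
  rewrite /= linearZ/= normrZ gtr0_norm// divfK ?gt_eqF//.
  by rewrite ltr_pdivrMr// ltr_pMr// ltr1n.
rewrite gK// sub0r normrN normrZ gtr0_norm// /c mulrAC ltr_pdivrMr// mul1r.
exact: ltW.
Qed.

Lemma isomorphism_on_upper (f : {linear V -> W}) : isomorphism_on setT f ->
  exists2 b, 0 < b & forall x, `|f x| <= b * `|x|.
Proof.
move=> [cf _]; have {}cf : continuous f by apply/continuous_subspace_setT.
have /linear_boundedP := (linear_bounded_continuous f).2 cf.
by move=> /pinfty_ex_gt0 [b b0 hb]; exists b.
Qed.

End isomorphism_bounds.

(** Signs are chosen by the parallelogram law in the Hilbert space and carried over; [B] is the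
    square of the distortion b / a of the isomorphism. *)
Lemma isomorphic_to_Hilbert_signs (R : realType) (V : normedModType R)
    (X : set V) : isomorphic_to_Hilbert X ->
  exists2 B, 0 < B & forall k (v : nat -> V), (forall l, X (v l)) ->
    exists s : nat -> bool,
      `|\sum_(l < k) (-1) ^+ s l *: v l| ^+ 2 <= B * \sum_(l < k) `|v l| ^+ 2.
Proof.
move=> [H [dot [dotE [J [iJ JX]]]]].
have [b b0 Jb] := isomorphism_on_upper iJ.
have [||a a0 Ja] := isomorphism_on_lower _ _ iJ; [by []|by []|].
exists ((b / a) ^+ 2); first by rewrite exprn_gt0// divr_gt0.
move=> k v Xv.
have /choice [w vw] : forall l, exists w, J w = v l.
  by move=> l; have := Xv l; rewrite -JX => -[w _ <-]; exists w.
have [||s hs] := @parallelogram_signs R H (fun w => `|w| ^+ 2) k w.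
- by rewrite normr0 expr0n.
- by move=> x y; rewrite !dotE !linearDr !linearDl /= !linearNr !linearNl; ring.
exists s.
have -> : \sum_(l < k) (-1) ^+ s l *: v l = J (\sum_(l < k) (-1) ^+ s l *: w l).
  by rewrite linear_sum; apply: eq_bigr => l _; rewrite linearZ/= vw.
apply: (@le_trans _ _ ((b * `|\sum_(l < k) (-1) ^+ s l *: w l|) ^+ 2)).
  by rewrite lerXn2r ?nnegrE// mulr_ge0// ltW.
rewrite expr_div_n exprMn -(mulrA _ (a ^+ 2)^-1) ler_pM2l ?exprn_gt0//.
apply: (le_trans hs); rewrite mulr_sumr; apply: ler_sum => l _.
rewrite ler_pdivlMl ?exprn_gt0// -exprMn lerXn2r ?nnegrE ?mulr_ge0 ?(ltW a0)//.
by rewrite -vw Ja.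
Qed.

Section lp_unit_vectors.
Context (R : realType) (p : R) (p1 : 1 <= p).

Let p0 : 0 < p. Proof. exact: lt_le_trans p1. Qed.

Lemma counting_ae (P : nat -> Prop) :
  {ae (@counting nat R), forall n, P n} -> forall n, P n.
Proof.
move=> [A [mA A0 PA]] n; apply: contrapT => Pn.
have An : A n by exact: PA.
have : (counting [set n] <= (0 : \bar R))%E.
  by rewrite -A0; apply: le_measure => [||_ ->//]; apply/mem_set.
rewrite /counting asboolT; last exact: finite_set1.
by rewrite fset_set1 finmap.cardfs1 lee_fin ler10.
Qed.

(** The unit vector basis: no choice of signs lowers the growth k^(1/p), to be compared with
    [sampling_signs]. *)
Lemma lp_unit_vectors : exists e : nat -> lp p1,
  (forall l, `|e l| <= 1) /\
  forall k (s : nat -> bool),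
    `|\sum_(l < k) (-1) ^+ s l *: e l| = k%:R `^ p^-1.
Proof.
have pmoment (h : nat -> R) : (\int[counting]_n (`|h n| `^ p)%:E =
    \sum_(0 <= n <oo) (`|h n| `^ p)%:E)%E.
  by rewrite ge0_integral_count// => n; rewrite lee_fin powR_ge0.
have pmomentk (h : nat -> R) k : (forall n, `|h n| = (n < k)%:R) ->
    (\int[counting]_n (`|h n| `^ p)%:E = (k%:R)%:E)%E.
  move=> hk; rewrite pmoment (nneseries_split _ k); last first.
    by move=> n _; rewrite lee_fin powR_ge0.
  rewrite add0n eseries0 ?adde0; last first.
    by move=> n kn _; rewrite hk ltnNge kn powR0// gt_eqF.
  rewrite sumEFin; congr (_%:E).
  rewrite (eq_big_nat _ _ (F2 := fun=> 1)); last first.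
    by move=> n /andP[_ nk]; rewrite hk nk powR1.
  by rewrite sumr_const_nat subn0.
have /choice [e he] : forall l, exists x : lp p1, (Lrepr x : nat -> R) =
    (fun n => (n == l)%:R) %[ae (@counting nat R)] /\ `|x| `^ p = 1.
  move=> l; have h1 : (\int[counting]_n (`|(n == l)%:R : R| `^ p)%:E = 1)%E.
    rewrite (pmoment (fun n => (n == l)%:R)) (nneseries_split _ l.+1);
      last first.
      by move=> n _; rewrite lee_fin powR_ge0.
    rewrite add0n eseries0 ?adde0; last first.
      by move=> n ln _; rewrite gtn_eqF//= normr0 powR0// gt_eqF.
    rewrite big_nat_recr//= eqxx normr1 powR1 big1_seq ?add0e// => n.
    rewrite mem_index_iota/= => nl.
    by rewrite ltn_eqF// normr0 powR0// gt_eqF.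
  have [||x [hx hn]] := @Lspace_of_pmoment _ _ _ (@counting nat R) p p1
    (fun n => (n == l)%:R).
  - by [].
  - by rewrite h1 ltry.
  by exists x; split=> //; apply: EFin_inj; rewrite -hn h1.
exists e; split=> [l|k s].
  apply: (@powR_le_cancel _ p p1) => //.
  by rewrite (he l).2 powR1.
(* Almost everywhere for the counting measure means everywhere, so representatives are computed
   coordinatewise. *)
have h n : Lrepr (\sum_(l < k) (-1) ^+ s l *: e l) n =
    if (n < k)%N then (-1) ^+ s n else 0 :> R.
  elim: k => [|k IH].
    rewrite big_ord0; have := counting_ae (Lrepr_sub (0 : lp p1) 0).
    by move=> /(_ n I); rewrite subrr => ->; rewrite subrr.
  have -> : \sum_(l < k.+1) (-1) ^+ s l *: e l =
      (-1) ^+ s k *: e k + \sum_(l < k) (-1) ^+ s l *: e l.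
    by rewrite big_ord_recr addrC.
  have /counting_ae /(_ n I) -> := Lrepr_lin ((-1) ^+ s k) (e k)
    (\sum_(l < k) (-1) ^+ s l *: e l).
  rewrite IH (counting_ae (he k).1 n I) ltnS (leq_eqVlt n).
  have [->|nk] /= := eqVneq (n : nat) k; first by rewrite ltnn mulr1 addr0.
  by rewrite mulr0 add0r.
set x := \sum_(l < k) _ in h *.
have : (`|x| `^ p)%:E = (k%:R)%:E.
  rewrite -pmoment_Lrepr; apply: pmomentk => n; rewrite h.
  by case: ifP => _; rewrite ?normr0// normrX normrN1 expr1n.
move=> [<-]; rewrite -powRrM mulfV ?gt_eqF//.
by rewrite powRr1.
Qed.

End lp_unit_vectors.

(** * The shift along chains of spikes *)

Section chains.
Local Open Scope nat_scope.

(* Flattens pairs [(i, n)]: [(chain i n).+1] has odd part [i.*2.+1] and 2-adic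
   valuation [n], so that [j.*2.+1] is the next index on the chain of [j]. *)
Definition chain i n := (2 ^ n * i.*2.+1).-1.
Definition level j := logn 2 j.+1.
(* The chain [i] stops at level [level i]: every length occurs infinitely
   often. *)
Definition last_link j := level j == level (j.+1 %/ 2 ^ level j)./2.

Lemma chainE i n : (chain i n).+1 = 2 ^ n * i.*2.+1.
Proof. by rewrite prednK// muln_gt0 expn_gt0. Qed.

Lemma level_chain i n : level (chain i n) = n.
Proof.
rewrite /level chainE lognM ?expn_gt0// pfactorK//.
by rewrite [logn 2 _](_ : _ = 0) ?addn0// logn_coprime// coprime2n/= odd_double.
Qed.

Lemma chainS i n : (chain i n).*2.+1 = chain i n.+1.
Proof. by apply: succn_inj; rewrite -doubleS !chainE expnS -mul2n mulnA. Qed.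

Lemma chain_inj i n i' n' : chain i n = chain i' n' -> i = i' /\ n = n'.
Proof.
move=> h; have nn' : n = n' by rewrite -(level_chain i n) h level_chain.
split=> //; have : (chain i n).+1 = (chain i' n).+1 by rewrite h nn'.
rewrite !chainE => /eqP; rewrite eqn_pmul2l ?expn_gt0// eqSS => /eqP.
exact: double_inj.
Qed.

Lemma last_link_chain i n : last_link (chain i n) = (n == level i).
Proof.
rewrite /last_link level_chain chainE mulKn ?expn_gt0//.
by rewrite (half_bit_double i true).
Qed.

Lemma level_le j : level j <= j.
Proof. by rewrite -ltnS ltn_logl. Qed.

Lemma level_next j : level j.*2.+1 = (level j).+1.
Proof. by rewrite /level -doubleS -mul2n lognM// logn_prime. Qed.

End chains.

Lemma sum_odd (V : nmodType) (F : nat -> V) m :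
  \sum_(i < m.*2) (if odd i then F i./2 else 0) = \sum_(j < m) F j.
Proof.
elim: m => [|m IH]; first by rewrite !big_ord0.
rewrite doubleS !big_ord_recr/= odd_double/= addr0 IH.
by rewrite uphalf_double.
Qed.

Section shift_operator.
Context (R : realType) (L : normedModType R) (p : R) (p1 : 1 < p) (p2 : p < 2).
Variables (r s : nat).
(** [s] ensures k^(1/p - 1/2) >= t_N^3 for k = t_N^s; [r] ensures that a spike of level n + 1 has
    norm at most t_n^-(s + 4). *)
Hypothesis hs : 3 <= s%:R * (p^-1 - 2^-1).
Hypothesis hr : 2 * (s + 4)%:R <= r%:R * (2 - p).

Definition height n := (2 ^ (r ^ n))%N.
Local Notation T n := ((height n)%:R : R).

Variables (phi : nat -> L -> R) (X : nat -> L) (C : R).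
Hypothesis phiP : forall j a u v, phi j (a *: u + v) = a * phi j u + phi j v.
Hypothesis C1 : 1 <= C.
Hypothesis phi_test : forall m (d : nat -> R) f,
  (forall j, `|d j| * T (level j) <= 2^-1) -> \sum_(j < m) d j ^+ 2 <= 1 ->
  \sum_(j < m) d j * phi j f <= C * `|f|.
Hypothesis phi_X : forall j k, phi k (X j) = (j == k)%:R.
Hypothesis X_upper2 : forall m (d : nat -> R),
  `|\sum_(j < m) d j *: X j| <= 2 * Num.sqrt (\sum_(j < m) d j ^+ 2).
Hypothesis X_norm : forall j, `|X j| `^ p = T (level j) `^ p / T (level j) ^+ 2.
Hypothesis L_complete : forall u : nat -> L,
  (forall e, 0 < e -> exists N, forall m n, (N <= m)%N -> (m <= n)%N ->
    `|u n - u m| <= e) -> exists l : L, u @ \oo --> l.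

Let p0 : 0 < p. Proof. exact: lt_trans p1. Qed.
Let pE : (1 <= p%:E)%E. Proof. by rewrite lee_fin ltW. Qed.

Lemma r_gt1 : (1 < r)%N.
Proof.
rewrite ltnNge; apply/negP => r1.
have r1' : r%:R <= 1 :> R by rewrite (ler_nat _ r 1).
have s4 : 4 <= (s + 4)%:R :> R by rewrite ler_nat leq_addl.
have p20 : 0 <= 2 - p by rewrite subr_ge0 ltW.
have := ler_wpM2r p20 r1'; move: hr p1; lra.
Qed.

Lemma height_ge n : (2 ^ n <= height n)%N.
Proof. by rewrite leq_exp2l// ltnW// ltn_expl// r_gt1. Qed.

Lemma heightS n : height n.+1 = (height n ^ r)%N.
Proof. by rewrite /height expnSr expnM. Qed.

Lemma height_gt0 n : (0 < height n)%N.
Proof. by rewrite expn_gt0. Qed.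

Lemma T_ge1 n : 1 <= T n.
Proof. by rewrite (ler_nat _ 1) height_gt0. Qed.

Let T0 n : 0 < T n. Proof. by rewrite ltr0n height_gt0. Qed.

Lemma height_mono m n : (m <= n)%N -> T m <= T n.
Proof.
move=> mn; rewrite ler_nat leq_exp2l//.
by rewrite leq_exp2l// r_gt1.
Qed.

Lemma X_le1 j : `|X j| <= 1.
Proof.
apply: (powR_le_cancel pE) => //; rewrite powR1 X_norm.
rewrite ler_pdivrMr ?exprn_gt0// mul1r -powR_mulrn ?ler0n//.
exact: (ler_powR (T_ge1 (level j)) (ltW p2)).
Qed.

(** The p-th power of the norm is t_(n+1)^(p - 2) with t_(n+1) = t_n^r, and [hr] with p <= 2 gives r
    (2 - p) >= p (s + 4). *)
Lemma X_next_le j : `|X j.*2.+1| <= (T (level j) ^+ (s + 4))^-1.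
Proof.
apply: (powR_le_cancel pE); rewrite ?invr_ge0 ?exprn_ge0//.
rewrite X_norm level_next heightS natrX; set t := T _.
have t1 : 1 <= t by exact: T_ge1.
have t0 : 0 < t by exact: T0.
rewrite -!powR_mulrn ?exprn_ge0 ?(ltW t0)//.
rewrite -!powRN -!powRrM -powRD; last by rewrite (gt_eqF t0) implybT.
apply: (ler_powR t1).
have sp : 0 <= (s + 4)%:R :> R by [].
have := ler_wpM2l sp (ltW p2); move: hr; lra.
exact: powR_ge0.
Qed.

(* The links of a chain telescope: they add up to the sum of the chain. *)
Definition link j : L := (if level j == 0%N then X j else 0) +
  (if last_link j then 0 else X j.*2.+1).

(** First spikes of chains and spikes following a link are two families with distinct indices;
    [X_upper2] contributes a factor 2 for each. *)
Lemma link_upper2 m (d : nat -> R) : `|\sum_(j < m) d j *: link j| <=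
  4 * Num.sqrt (\sum_(j < m) d j ^+ 2).
Proof.
set S := \sum_(j < m) d j ^+ 2.
have -> : \sum_(j < m) d j *: link j =
    \sum_(j < m) (if level j == 0%N then d j else 0) *: X j +
    \sum_(j < m) (if last_link j then 0 else d j) *: X j.*2.+1.
  rewrite -big_split; apply: eq_bigr => j _; rewrite /link scalerDr.
  by case: ifP => _; case: ifP => _; rewrite ?scaler0 ?scale0r.
have -> : 4 * Num.sqrt S = 2 * Num.sqrt S + 2 * Num.sqrt S by ring.
apply: (le_trans (ler_normD _ _)); apply: lerD.
  apply: (le_trans (X_upper2 m (fun j => if level j == 0%N then d j else 0))).
  rewrite ler_pM2l//; apply: ler_wsqrtr.
  apply: ler_sum => j _; case: ifP => // _.
  by rewrite expr0n/= sqr_ge0.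
pose w j := if last_link j then 0 else d j.
(* Next links occupy odd indices: the sum is rewritten over all i < 2 m with coefficient 0 at even
   i. *)
have -> : \sum_(j < m) (if last_link j then 0 else d j) *: X j.*2.+1 =
    \sum_(i < m.*2) (if odd i then w i./2 else 0) *: X i.
  rewrite -(sum_odd (fun j => w j *: X j.*2.+1)); apply: eq_bigr => i _.
  case: ifP => oi; rewrite ?scale0r//; congr (_ *: X _).
  by rewrite -[RHS]odd_double_half oi.
apply: (le_trans (X_upper2 m.*2 (fun i => if odd i then w i./2 else 0))).
rewrite ler_pM2l//; apply: ler_wsqrtr.
rewrite (eq_bigr (fun i : 'I_m.*2 => if odd i then w i./2 ^+ 2 else 0)).
  rewrite (sum_odd (fun j => w j ^+ 2)); apply: ler_sum => j _; rewrite /w.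
  by case: ifP => // _; rewrite expr0n/= sqr_ge0.
by move=> i _; case: ifP => // _; rewrite expr0n.
Qed.

(** Normalised so that [link_size 0] is 2: a link of level 0 consists of at most two spikes of norm
    at most 1. *)
Let A : R := 2 * T 0 ^+ (s + 4).
Definition link_size n : R := A / T n ^+ (s + 4).

Let A1 : 1 <= A.
Proof.
rewrite /A (le_trans (_ : 1 <= T 0 ^+ (s + 4)))//.
  by rewrite exprn_ege1 ?T_ge1.
by rewrite ler_peMl ?exprn_ge0// ler1n.
Qed.

Lemma link_size_ge0 n : 0 <= link_size n.
Proof. by rewrite /link_size divr_ge0 ?exprn_ge0// (le_trans _ A1). Qed.

Lemma link_small j : `|link j| <= link_size (level j).
Proof.
rewrite /link_size; have [l0|l0] := eqVneq (level j) 0%N.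
  rewrite l0 /A mulfK ?gt_eqF ?exprn_gt0// /link l0 eqxx.
  rewrite (le_trans (ler_normD _ _))// (_ : 2 = 1 + 1)//.
  by apply: lerD; [exact: X_le1|case: ifP => _; rewrite ?normr0 ?X_le1].
rewrite /link (negbTE l0) add0r; case: ifP => _.
  by rewrite normr0 link_size_ge0.
by rewrite (le_trans (X_next_le j))// ler_peMl// invr_ge0.
Qed.

Definition link_tail N : R := 2 * A / T N ^+ s.

(** Of the exponent s + 4, three powers absorb t_n^3, one gives t_n^-1 <= 2^-n for summability, and
    t_n^-s <= t_N^-s remains. *)
Lemma link_tailP N M :
  \sum_(N <= n < M) T n ^+ 3 * link_size n <= link_tail N.
Proof.
have A0 : 0 <= A by rewrite (le_trans _ A1).
apply: (@le_trans _ _ (\sum_(N <= n < M) A / T N ^+ s * 2^-1 ^+ n)).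
  rewrite big_nat_cond [leRHS]big_nat_cond.
  apply: ler_sum => n /andP[/andP[Nn _] _].
  rewrite /link_size mulrCA -mulrA; apply: ler_wpM2l => //.
  have -> : (s + 4 = s + 1 + 3)%N by rewrite -addnA.
  rewrite exprD invfM mulrCA mulfV ?gt_eqF ?exprn_gt0// mulr1 exprD invfM expr1.
  apply: ler_pM; rewrite ?invr_ge0 ?exprn_ge0//.
    rewrite lef_pV2 ?posrE ?exprn_gt0//.
    by rewrite lerXn2r ?nnegrE ?ler0n// height_mono.
  rewrite exprVn lef_pV2 ?posrE ?exprn_gt0//.
  by rewrite -natrX ler_nat height_ge.
rewrite -mulr_sumr (le_trans (ler_wpM2l _ (half_geometric_sum R N M)))//.
  by rewrite divr_ge0 ?exprn_ge0.
rewrite /link_tail mulrCA -(mulrA 2 A) ler_pM2l// ler_piMr//.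
  by rewrite divr_ge0 ?exprn_ge0.
by rewrite exprn_ile1// invf_le1// ler1n.
Qed.

Lemma shift_exists : exists S : {linear L -> L},
  (forall f, sampling phi link m f @[m --> \oo] --> S f) /\
  (forall f, `|S f| <= sampling_bound link_tail C 4 * `|f|).
Proof.
apply: (@sampling_operator R L phi link level (fun n => T n) link_size) => //.
- exact: level_le.
- exact: T_ge1.
- exact: link_upper2.
- exact: link_size_ge0.
- exact: link_small.
- exact: link_tailP.
Qed.

Variable S : {linear L -> L}.
Hypothesis S_lim : forall f, sampling phi link m f @[m --> \oo] --> S f.

Lemma shift_X j : S (X j) = link j.
Proof.
suff h : sampling phi link m (X j) @[m --> \oo] --> link j.
  exact: (cvg_unique (@norm_hausdorff _ _) (@S_lim (X j)) h).
apply: cvg_near_cst; exists j.+1 => // m /= jm.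
rewrite /sampling (bigD1 (Ordinal jm))//= phi_X eqxx scale1r big1 ?addr0//.
move=> k kj; rewrite phi_X (_ : (j == k :> nat) = false) ?scale0r//.
by apply/negbTE; rewrite eq_sym.
Qed.

Definition chain_sum i := \sum_(n < (level i).+1) X (chain i n).

(** The link of level 0 restores the first spike, and every link but the last produces the next
    spike of the chain. *)
Lemma shift_chain_sum i : S (chain_sum i) = chain_sum i.
Proof.
rewrite /chain_sum linear_sum.
rewrite (eq_bigr (fun n : 'I_(level i).+1 =>
  (if n == 0%N :> nat then X (chain i n) else 0) +
  (if n == level i :> nat then 0 else X (chain i n.+1)))); last first.
  by move=> n _; rewrite shift_X /link level_chain last_link_chain chainS.
rewrite big_split/= [X in X + _]big_ord_recl/= big1 ?addr0//.
rewrite big_ord_recr/= eqxx addr0 [RHS]big_ord_recl; congr (_ + _).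
by apply: eq_bigr => n _; rewrite (ltn_eqF (ltn_ord n)).
Qed.

(** The first spike has norm at most 1 and the one of level n + 1 at most 2^-n, so the bound does
    not depend on the length of the chain. *)
Lemma chain_sum_le i : `|chain_sum i| <= 3.
Proof.
rewrite /chain_sum big_ord_recl (_ : 3 = 1 + 2)// (le_trans (ler_normD _ _))//.
  apply: lerD; first exact: X_le1.
  apply: (@le_trans _ _ (\sum_(0 <= n < level i) 2^-1 ^+ n)); last first.
    by rewrite (le_trans (half_geometric_sum R 0 _))// expr0 mulr1.
  rewrite big_mkord (le_trans (ler_norm_sum _ _ _))//; apply: ler_sum => n _.
  rewrite -[chain _ _]/(chain i n.+1) -chainS (le_trans (X_next_le _))//.
  rewrite level_chain exprVn lef_pV2 ?posrE ?exprn_gt0//.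
  apply: (@le_trans _ _ (T n)); first by rewrite -natrX ler_nat height_ge.
  by rewrite -{1}(expr1 (T n)) ler_weXn2l ?T_ge1// addn_gt0 orbT.
Qed.

(** With k = t_N^s vectors, the wild parts beyond level N add up to a bounded amount. *)
Let link_tail_le N : (height N ^ s)%:R * link_tail N <= 2 * A.
Proof. by rewrite natrX /link_tail mulrC divfK// gt_eqF// exprn_gt0. Qed.

(** Crude count: N levels of energy at most (2 C t_N)^2 each, and N <= t_N^2. The order t_N^4 is
    enough, since its root t_N^2 loses against t_N^3. *)
Lemma hilbert_bound_height N :
  hilbert_bound (fun n => T n) C N <= (3 * C * T N ^+ 2) ^+ 2.
Proof.
have C0 : 0 < C by exact: lt_le_trans C1.
apply: (@le_trans _ _ (C ^+ 2 * T N ^+ 4 + N%:R * (2 * C * T N) ^+ 2)).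
  apply: lerD; first by rewrite ler_peMr ?sqr_ge0// exprn_ege1 ?T_ge1.
  have -> : N%:R * (2 * C * T N) ^+ 2 = \sum_(n < N) (2 * C * T N) ^+ 2.
    by rewrite sumr_const card_ord mulr_natl.
  apply: ler_sum => n _; rewrite lerXn2r ?nnegrE ?mulr_ge0 ?(ltW C0)//.
  rewrite ler_wpM2l ?mulr_ge0 ?(ltW C0)//.
  by apply: height_mono; exact: ltnW.
have TN : N%:R <= T N ^+ 2.
  apply: (@le_trans _ _ (T N)); last by rewrite ler_eXnr ?T_ge1.
  by rewrite ler_nat (leq_trans _ (height_ge N))// ltnW// ltn_expl.
have C2 : 0 <= (2 * C * T N) ^+ 2 by exact: sqr_ge0.
apply: (@le_trans _ _ (C ^+ 2 * T N ^+ 4 + T N ^+ 2 * (2 * C * T N) ^+ 2)).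
  by rewrite lerD2l ler_wpM2r.
rewrite -subr_ge0 (_ : _ - _ = 4 * (C ^+ 2 * T N ^+ 4)); last by ring.
by rewrite !mulr_ge0// ?exprn_ge0// ltW.
Qed.

(** On a copy of l_p preserved by S, signed sums of k normalised unit vectors have images of norm at
    least [ga] k^(1/p), whereas [sampling_signs] with k = t_N^s finds signs giving O(t_N^2 sqrt k).
    As k^(1/p) >= t_N^3 sqrt k, the heights would be bounded. *)
Lemma shift_strictly_singular : strictly_singular (lp (ltW p1)) S.
Proof.
move=> [Z [[[Z0 Zlin] _] [J [iJ JZ]] iS]].
have [be be0 Jle] := isomorphism_on_upper iJ.
have [||al al0 Jge] := isomorphism_on_lower _ _ iJ; [by []|by []|].
have ZZ a x : Z x -> Z (a *: x).
  move=> Zx; have := Zlin a x 0 (mem_set Zx) Z0.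
  by rewrite addr0 => /set_mem.
have [||a a0 Sge] := isomorphism_on_lower _ _ iS.
- exact: set_mem Z0.
- exact: ZZ.
have [e [e1 ek]] := lp_unit_vectors (ltW p1).
pose v l := be^-1 *: J (e l).
have v1 l : `|v l| <= 1.
  rewrite /v normrZ gtr0_norm ?invr_gt0// ler_pdivrMl// mulr1.
  by rewrite (le_trans (Jle _))// ler_piMr// ltW.
(* Lower bound of S on Z, normalisation of [J (e l)], lower bound of [J]. *)
pose ga := a * be^-1 * al.
have ga0 : 0 < ga by rewrite !mulr_gt0// invr_gt0.
have low k (w : nat -> bool) :
    ga * k%:R `^ p^-1 <= `|S (\sum_(l < k) (-1) ^+ w l *: v l)|.
  have -> : \sum_(l < k) (-1) ^+ w l *: v l =
      be^-1 *: J (\sum_(l < k) (-1) ^+ w l *: e l).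
    rewrite linear_sum scaler_sumr; apply: eq_bigr => l _.
    by rewrite /v [in RHS](linearZZ J) !scalerA mulrC.
  apply: le_trans (Sge _ _); last by apply: ZZ; rewrite -JZ; eexists.
  rewrite /ga -!mulrA ler_pM2l// normrZ gtr0_norm ?invr_gt0//.
  by rewrite ler_pM2l ?invr_gt0// -(ek k w) Jge.
pose M := 1 + 8 * C ^+ 2 * (2 * A) + 4 * (3 * C).
have M0 : 0 <= 8 * C ^+ 2 * (2 * A).
  apply: mulr_ge0; first by rewrite mulr_ge0// sqr_ge0.
  by apply: mulr_ge0 => //; exact: le_trans A1.
have C0 : 0 < C by exact: lt_le_trans C1.
(* For [k = t_N ^ s] vectors the wild part beyond level [N] is negligible and
   the Hilbertian part is [O(t_N ^ 2 * sqrt k)], much less than [k `^ p^-1]. *)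
have main N : ga * T N <= M.
  pose k := (height N ^ s)%N.
  have k1 : 1 <= k%:R :> R by rewrite (ler_nat _ 1) expn_gt0 height_gt0.
  have k0 : 0 < k%:R :> R by exact: lt_le_trans k1.
  have [w hw] := @sampling_signs R L phi link level (fun n => T n) link_size
    link_tail C 4 C1 (ler0n _ _) level_le T_ge1 phi_test link_upper2
    link_size_ge0 link_small link_tailP S k N v S_lim v1.
  have {hw} hw := le_trans (low k w) hw.
  have kp : k%:R `^ p^-1 = Num.sqrt k%:R * k%:R `^ (p^-1 - 2^-1).
    rewrite -powR12_sqrt ?ler0n// -powRD ?subrKC//.
    by rewrite (gt_eqF k0) implybT.
  have kT : T N ^+ 3 <= k%:R `^ (p^-1 - 2^-1).
    have -> : k%:R = T N `^ s%:R by rewrite /k natrX powR_mulrn.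
    rewrite -powRrM -powR_mulrn ?ler0n//.
    exact: (ler_powR (T_ge1 N) hs).
  pose sk := Num.sqrt (k%:R : R).
  have sk1 : 1 <= sk by rewrite -sqrtr1 ler_wsqrtr.
  have sk0 : 0 < sk by exact: lt_le_trans sk1.
  have T2 : 1 <= T N ^+ 2 by rewrite exprn_ege1 ?T_ge1.
  have : ga * (sk * T N ^+ 3) <= M * (sk * T N ^+ 2).
    apply: (@le_trans _ _ (ga * k%:R `^ p^-1)).
      by rewrite kp ler_pM2l// ler_pM2l.
    apply: (le_trans hw); rewrite /M [leRHS]mulrDl; apply: lerD.
      have sT1 : 1 <= sk * T N ^+ 2 by rewrite mulr_ege1.
      apply: (@le_trans _ _ (1 + 8 * C ^+ 2 * (2 * A))).
        rewrite lerD2l mulrCA; apply: ler_wpM2l; last exact: link_tail_le.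
        by rewrite mulr_ge0// sqr_ge0.
      by rewrite ler_peMr// addr_ge0.
    have hH : Num.sqrt (hilbert_bound (fun n => T n) C N) <= 3 * C * T N ^+ 2.
      have CT : 0 <= 3 * C * T N ^+ 2.
        by apply: mulr_ge0; [rewrite mulr_ge0// ltW|rewrite exprn_ge0].
      rewrite -[leRHS](ger0_norm CT) -sqrtr_sqr; apply: ler_wsqrtr.
      exact: hilbert_bound_height.
    rewrite sqrtrM ?ler0n// -/sk.
    have -> : 4 * (3 * C) * (sk * T N ^+ 2) = 4 * (sk * (3 * C * T N ^+ 2)).
      by ring.
    by rewrite ler_pM2l// ler_pM2l.
  have -> : ga * (sk * T N ^+ 3) = ga * T N * (sk * T N ^+ 2) by ring.
  by rewrite ler_pM2r// mulr_gt0// (lt_le_trans _ T2).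
have [N hN] := natr_unbounded (M / ga).
have := main N; apply/negP; rewrite -ltNge mulrC -ltr_pdivrMr//.
apply: (lt_le_trans hN).
by rewrite ler_nat (leq_trans _ (height_ge N))// ltnW// ltn_expl.
Qed.

(** Turns signed sums over pairs (chain, level) into sums over an initial segment of indices, the
    form in which [phi_test] applies. *)
Lemma injective_signs_sum (I : finType) (g : I -> nat) (u : I -> R) :
  injective g -> (forall a, u a ^+ 2 = 1) ->
  exists m (c : nat -> R), [/\
    \sum_(a : I) u a *: X (g a) = \sum_(j < m) c j *: X j,
    \sum_(j < m) c j ^+ 2 = #|I|%:R &
    forall j, c j = 0 \/ `|c j| = 1 /\ exists a, j = g a].
Proof.
move=> gI u1; pose c j := \sum_(a | g a == j) u a.
have cP j : c j = 0 \/ exists2 a, j = g a & c j = u a.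
  have [[a ja]|nj] := pselect (exists a, j = g a); [right; exists a => //|left].
    by rewrite /c (big_pred1 a)// => a'; rewrite ja (inj_eq gI).
  by rewrite /c big_pred0// => a; apply/eqP => ga; apply: nj; exists a.
pose m := (\max_a g a).+1.
have gm a : (g a < m)%N by rewrite ltnS (leq_bigmax a).
exists m, c; split.
- rewrite (partition_big (fun a => Ordinal (gm a)) predT)//=.
  apply: eq_bigr => j _; rewrite /c scaler_suml.
  rewrite (eq_bigl (fun a => g a == j)); last by move=> a; rewrite -val_eqE.
  by apply: eq_bigr => a /eqP ->.
- transitivity (\sum_(a : I) (1 : R)); last first.
    by rewrite sumr_const -mulr_natl mulr1.
  rewrite (partition_big (fun a => Ordinal (gm a)) predT)//=.
  apply: eq_bigr => j _.
  rewrite (eq_bigl (fun a => g a == j)); last by move=> a; rewrite -val_eqE.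
  have [[a ja]|nj] := pselect (exists a, (j : nat) = g a).
    have e : (fun a' => g a' == j) =1 pred1 a.
      by move=> a'; rewrite ja (inj_eq gI).
    by rewrite /c !(eq_bigl _ _ e) !big_pred1_eq u1.
  have e : (fun a' => g a' == j) =1 pred0.
    by move=> a; apply/eqP => ga; apply: nj; exists a.
  by rewrite /c !(eq_bigl _ _ e) !big_pred0_eq expr0n.
- move=> j; have [->|[a ja ->]] := cP j; [by left|right].
  split; last by exists a.
  by apply/eqP; rewrite -sqr_norm_eq1 u1.
Qed.

Lemma phi_X_sum m (c : nat -> R) j :
  phi j (\sum_(i < m) c i *: X i) = if (j < m)%N then c j else 0.
Proof.
have phi0 : phi j 0 = 0.
  have := phiP j 1 0 0; rewrite scaler0 addr0 mul1r => /eqP.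
  by rewrite -subr_eq subrr => /eqP.
elim: m => [|m IH]; first by rewrite big_ord0 phi0.
rewrite big_ord_recr/= addrC phiP IH phi_X ltnS (leq_eqVlt j) eq_sym.
have [->|jm] /= := eqVneq m j; first by rewrite ltnn mulr1 addr0.
by rewrite mulr0 add0r.
Qed.

(** In a Hilbertian space some signed sum Y of k chain sums has |Y|^2 <= 9 B k. Testing Y against
    its own normalised coefficients gives k (N + 1) <= C^2 |Y|^2, so N would be bounded. *)
Lemma shift_fixed_not_Hilbert : ~ isomorphic_to_Hilbert [set f | S f = f].
Proof.
move=> /isomorphic_to_Hilbert_signs[B B0 hB].
have C0 : 0 < C by exact: lt_le_trans C1.
have main N : N.+1%:R <= C ^+ 2 * (B * 9).
  (* Then sqrt(k (N + 1)) >= 2 t_N, so coefficients of modulus 1 / sqrt(k (N + 1)) meet the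
     thresholds of all levels up to N. *)
  pose k := (4 * height N ^ 2)%N.
  have k0 : 0 < k%:R :> R by rewrite ltr0n muln_gt0/= expn_gt0 height_gt0.
  (* The chain number [chain l N] has level N: these are different chains, all with N + 1 spikes. *)
  pose v l := chain_sum (chain l N).
  have [l /=|w hw] := hB k v; first exact: shift_chain_sum.
  set Y := \sum_(l < k) _ in hw.
  have hY : `|Y| ^+ 2 <= B * 9 * k%:R.
    apply: (le_trans hw); rewrite -mulrA ler_pM2l// mulrC mulr_natl.
    have -> : 9 *+ k = \sum_(l < k) (9 : R) by rewrite sumr_const card_ord.
    apply: ler_sum => l _; have -> : 9 = 3 ^+ 2 :> R by ring.
    by rewrite lerXn2r ?nnegrE// chain_sum_le.
  pose g (a : 'I_k * 'I_N.+1) := chain (chain a.1 N) a.2.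
  have gI : injective g.
    move=> [l n] [l' n'] /chain_inj[/chain_inj[/= ll' _] /= nn'].
    by congr (_, _); exact: val_inj.
  pose u (a : 'I_k * 'I_N.+1) : R := (-1) ^+ w a.1.
  have [m [c [cY c2 cP]]] := injective_signs_sum gI
    (fun a => sqrr_sign R (w (a : 'I_k * 'I_N.+1).1) : u a ^+ 2 = 1).
  have {}cY : Y = \sum_(j < m) c j *: X j.
    rewrite -cY -(pair_bigA _ (fun l n => u (l, n) *: X (g (l, n))))/=.
    apply: eq_bigr => l _; rewrite /u/= -scaler_sumr; congr (_ *: _).
    by rewrite /v /chain_sum level_chain.
  rewrite card_prod !card_ord natrM in c2.
  set s2 : R := k%:R * N.+1%:R in c2.
  have s20 : 0 < s2 by rewrite mulr_gt0.
  pose sg := Num.sqrt s2.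
  have sg0 : 0 < sg by rewrite sqrtr_gt0.
  have sgT : 2 * T N <= sg.
    have T2 : 0 <= 2 * T N by rewrite mulr_ge0.
    rewrite -[leLHS](ger0_norm T2) -sqrtr_sqr; apply: ler_wsqrtr.
    apply: (@le_trans _ _ k%:R); last by rewrite ler_peMr ?ler1n// ltW.
    by rewrite /k natrM natrX exprMn -(natrX _ 2 2).
  have := @phi_test m (fun j => c j / sg) Y.
  have -> : \sum_(j < m) (c j / sg) ^+ 2 = 1.
    under eq_bigr do rewrite expr_div_n.
    by rewrite -mulr_suml c2 sqr_sqrtr ?(ltW s20)// mulfV ?gt_eqF.
  have -> : \sum_(j < m) c j / sg * phi j Y = sg.
    rewrite cY (eq_bigr (fun j : 'I_m => c j ^+ 2 / sg)).
      rewrite -mulr_suml c2 -{1}(sqr_sqrtr (ltW s20)) -/sg expr2 mulfK//.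
      by rewrite gt_eqF.
    by move=> j _; rewrite phi_X_sum ltn_ord mulrAC expr2.
  move=> /(_ _ (lexx _)) h; have {}h : sg <= C * `|Y|.
    apply: h => j; have [->|[c1 [[l n] jg]]] := cP j.
      by rewrite mul0r normr0 mul0r.
    rewrite normrM c1 mul1r jg /g/= level_chain normfV (gtr0_norm sg0) mulrC.
    rewrite ler_pdivrMr// ler_pdivlMl//.
    apply: le_trans sgT; rewrite ler_pM2l//; apply: height_mono.
    by rewrite -ltnS ltn_ord.
  have h2 : s2 <= (C * `|Y|) ^+ 2.
    rewrite -[leLHS](sqr_sqrtr (ltW s20)) lerXn2r ?nnegrE ?sqrtr_ge0//.
    by rewrite mulr_ge0// ltW.
  rewrite -(ler_pM2l k0) -/s2 (le_trans h2)// exprMn.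
  have -> : k%:R * (C ^+ 2 * (B * 9)) = C ^+ 2 * (B * 9 * k%:R) by ring.
  by rewrite ler_pM2l// exprn_gt0.
have [N hN] := natr_unbounded (C ^+ 2 * (B * 9)).
have := main N; apply/negP; rewrite -ltNge (lt_le_trans hN)//.
by rewrite ler_nat.
Qed.

End shift_operator.

(** * The operator on L_p(0,1) *)

Definition unit_measure (R : realType)
  : {measure set (measurableTypeR R) -> \bar R} :=
  mrestr (@lebesgue_measure R) (measurable_itv `]0%R, 1%R[).

Theorem mainTheorem3 (R : realType) (p : R) (p1 : 1 < p) (p2 : p < 2) :
  exists (T : {linear Lp01 (ltW p1) -> Lp01 (ltW p1)})
    (X : set (Lp01 (ltW p1))),
    [/\ bounded_fun_norm T,
        strictly_singular (lp (ltW p1)) T,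
        closed_subspace X,
        isomorphism_on X T &
        ~ isomorphic_to_Hilbert X].
Proof.
have p0 : 0 < p by exact: lt_trans p1.
(* First [s], depending on p, then [r], depending on p and [s]; p < 2 makes both factors
   positive. *)
have [s hs] : exists s : nat, 3 <= s%:R * (p^-1 - 2^-1).
  have dp : 0 < p^-1 - 2^-1 by rewrite subr_gt0 ltf_pV2 ?posrE.
  have [s /ltW hs] := natr_unbounded (3 / (p^-1 - 2^-1)).
  by exists s; rewrite -ler_pdivrMr.
have [r hr] : exists r : nat, 2 * (s + 4)%:R <= r%:R * (2 - p).
  have dp : 0 < 2 - p by rewrite subr_gt0.
  have [r /ltW hr] := natr_unbounded (2 * (s + 4)%:R / (2 - p)).
  by exists r; rewrite -ler_pdivrMr.
pose b j := height r (level j).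
have b0 j : (0 < b j)%N by exact: height_gt0.
pose mu := unit_measure R.
have mu1 : mu setT = 1%E := mu_unit R.
pose L := Lp01 (ltW p1).
have mg : forall K n, measurable [set t | grid K t = n] := @measurable_grid_eq R.
have mug : forall K a, (0 < K)%N -> (a < K)%N ->
  mu [set t | grid K t = a] = (K%:R^-1)%:E := @mu_grid_eq R.
have aeg : forall K, (0 < K)%N -> {ae mu, forall t, (grid K t < K)%N} :=
  @ae_grid_ltn R.
have gd := @grid_divn R.
have [X /all_and2[X1 X2]] := @spike_class _ _ R mu (@grid R) mu1 mg mug aeg
  b b0 p p1 (ltW p1).
pose phi j (f : L) := @spike_coef _ _ R mu (@grid R) b p (ltW p1) j f.
pose C := @test_bound R p.
have C1 : 1 <= C by exact: test_bound_ge1.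
have phiP : forall j a (u v : L), phi j (a *: u + v) = a * phi j u + phi j v.
  by move=> j a u v; exact: (spike_coefP mu1 mg).
have phi_test : forall m (d : nat -> R) (f : L),
    (forall j, `|d j| * (height r (level j))%:R <= 2^-1) ->
    \sum_(j < m) d j ^+ 2 <= 1 -> \sum_(j < m) d j * phi j f <= C * `|f|.
  by move=> m d f; exact: (spike_test mu1 mg mug aeg gd b0 p1).
have phi_X : forall j k, phi k (X j) = (j == k)%:R.
  exact: (spike_coef_class mu1 mg mug aeg gd b0 X1).
have X_upper2 : forall m (d : nat -> R), `|\sum_(j < m) d j *: (X j : L)| <=
    2 * Num.sqrt (\sum_(j < m) d j ^+ 2).
  exact: (spike_upper2 mu1 mg mug aeg gd b0 p1 (ltW p2) X1).
have Lc : forall u : nat -> L,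
  (forall e, 0 < e -> exists N, forall m n, (N <= m)%N -> (m <= n)%N ->
    `|u n - u m| <= e) -> exists l : L, u @ \oo --> l.
  exact: Lspace_complete.
have [S [S_lim S_bd]] := shift_exists p1 p2 hr phiP C1 phi_test X_upper2 X2 Lc.
exists S, [set f | S f = f].
have cS : continuous S.
  apply/linear_bounded_continuous/linear_boundedP; near=> M => f.
  by apply: (le_trans (S_bd f)); rewrite ler_wpM2r//; near: M;
    exact: nbhs_pinfty_ge.
split.
- move=> M; exists (`|sampling_bound (link_tail R r s) C 4| * M) => f fM.
  apply: (le_trans (S_bd f)); apply: (le_trans (ler_norm _)).
  by rewrite normrM normr_id ler_wpM2l.
- exact: (shift_strictly_singular p2 hs hr C1 phi_test X_upper2 X2 S_lim).
- split.
    split; first by apply/mem_set; exact: linear0.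
    move=> a u v /set_mem Su /set_mem Sv; apply/mem_set => /=.
    by rewrite linearP Su Sv.
  (* The fixed points are the preimage of 0 under the continuous map S - id, hence closed. *)
  have -> : [set f | S f = f] = (fun f => S f - f) @^-1` [set 0].
    apply/seteqP; split => f /= h; first by rewrite /preimage/= h subrr.
    by apply/eqP; rewrite -subr_eq0; apply/eqP.
  apply: closed_comp; last first.
    exact: (accessible_closed_set1 (hausdorff_accessible (@norm_hausdorff _ _))).
  by move=> f _; exact: (cvgB (cS f) (@cvg_id _ (nbhs f))).
- split; first exact: continuous_subspaceT.
  (* S is the identity on its fixed points, so the identity is the inverse. *)
  exists id; first by apply: continuous_subspaceT => f; exact: cvg_id.
  by move=> f /= ->.
- exact: (shift_fixed_not_Hilbert p1 p2 hr phiP C1 phi_test phi_X X2 S_lim).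
Unshelve. all: by end_near.
Qed.
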